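(* Up to multiplication by elements of $\Bbbk^\times$, $$\Delta_{A/R}=\prod_{l\in \{l_\tau\,\mid\,\tau\in\mathcal P\setminus G'\}} l^{\,p-1}=\bigl((\sigma-1)(\Pi_H x_n)\bigr)^{p-1},$$ where the product in the middle is over the set of distinct linear forms $l\in S_1$ such that $l=l_\tau$ for some $\tau\in\mathcal P\setminus G'$.
   Context: Let $p$ be a prime, $\Bbbk$ a field of characteristic $p$, $S=\Bbbk[x_1,\ldots,x_n]$ with $\deg x_i=1$, and let $G\subseteq \mathrm{GL}_n(\Bbbk)$ be a finite $p$-group acting on $S$ by degree-preserving $\Bbbk$-algebra automorphisms. A pseudo-reflection in $G$ is an element $\tau$ such that $\{l\in S_1 \mid \tau l=l\}$ has dimension $n-1$ over $\Bbbk$; every pseudo-reflection in the $p$-group $G$ is a transvection. Let $\mathcal P$ be the set of transvections in $G$. Assume that $G$ is generated by $\mathcal P$ and that for all $g\in G$, $gx_1=x_1$ and $gx_i-x_i\in \Bbbk\langle x_1,\ldots,x_{i-1}\rangle$ (the $\Bbbk$-span) for $2\le i\le n$. For $g\in\mathcal P$ let $\beta_g$ be the largest $j$ such that $x_j$ appears with non-zero coefficient in $gx_i-x_i$ for some $i$. For a subgroup $N$ of $G$ generated by transvections let $\beta_N=\max\{\beta_g\mid g\in \mathcal P\cap N\}$ (read as $0$ if $N$ is trivial). For $\tau\in\mathcal P$, $l_\tau\in S_1$ is the unique linear form that generates the ideal of $S$ generated by $\{\tau s-s\mid s\in S\}$ and in which $x_{\beta_\tau}$ has coefficient $1$. The group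 $G$ has a composition series $0=G_0\subsetneq G_1\subsetneq\cdots\subsetneq G_k=G$ such that for each $1\le i\le k$: $G_i$ is generated by transvections; $G_i/G_{i-1}\simeq \mathbb Z/p\mathbb Z$ is generated by the class of a transvection; and $\beta_{G_i}\ge\beta_{G_{i-1}}$. Let $G'=G_{k-1}$ for such a series, with $\beta_\tau\ge\beta_{G'}$ for all $\tau\in\mathcal P\setminus G'$. Thus $G'$ is normal in $G$, generated by transvections, and $G/G'\simeq\mathbb Z/p\mathbb Z$ is generated by the class of a transvection $\sigma\in G\setminus G'$. Assume moreover that $\beta_\sigma>\beta_{G'}$ and that the coordinates are chosen so that $\sigma x_i=x_i$ for all $i\ne n$. Let $H$ be the subgroup of $G'$ generated by the transvections $g\in G'$ with $gx_i=x_i$ for all $i\neq n$, and let $\Pi_H x_n=\prod_{s'\in Hx_n}s'$ be the product over the $H$-orbit of $x_n$. Write $R=S^G$, $A=S^{G'}$, $K=\mathrm{Frac}(R)$, $F=\mathrm{Frac}(A)$. The Dedekind different of $A/R$ is the ideal $\mathscr D_D(A/R)=\{x\in F\mid x\cdot C\subseteq A\}$ of $A$, where $C=\{y\in F\mid \mathrm{Tr}_{F/K}(yA)\subseteq R\}$. It is a homogeneous principal ideal of the UFD $A$; $\Delta_{A/R}$ denotes a homogeneous generator of it. *)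

(* Defs.v *)
From mathcomp Require Import all_boot all_order all_fingroup all_algebra.
From mathcomp Require Import pgroup mxrepresentation.
From mathcomp Require Import mpoly.
From Stdlib Require Import ClassicalEpsilon.

Set Implicit Arguments.
Unset Strict Implicit.
Unset Printing Implicit Defensive.

Import GRing.Theory.
Local Open Scope ring_scope.

(* The variables x_1, ..., x_n of the mathematical text are 'X_i for
   i : 'I_n.+1, so the number of variables is n.+1 (there is at least one) and
   the last variable is 'X_ord_max. *)

(* Column i of M holds the coordinates of M x_i, so that
   gl_act (M *m N) f = gl_act M (gl_act N f): a left action by k-algebra maps. *)
Definition gl_act (k : fieldType) (n : nat) (M : 'M[k]_n.+1)
    (f : {mpoly k[n.+1]}) : {mpoly k[n.+1]} :=
  f \mPo [tuple \sum_(j < n.+1) M j i *: 'X_j | i < n.+1].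

(* A linear form with coordinate row u is fixed by M iff u *m M^T = u, so the
   rank below is the dimension of {l in S_1 | M l = l}. *)
Definition pseudo_reflection (k : fieldType) (n : nat) (M : 'M[k]_n.+1) : bool :=
  \rank (eigenspace M^T 1) == n.

(* A transvection fixes a hyperplane pointwise and acts trivially modulo that
   hyperplane, that is, M - 1 maps S_1 into {l in S_1 | M l = l}. *)
Definition transvection (k : fieldType) (n : nat) (M : 'M[k]_n.+1) : bool :=
  pseudo_reflection M && ((M - 1) ^+ 2 == 0).

(* One-based, so that the value 0 is left for the case where M is trivial. *)
Definition beta (k : fieldType) (n : nat) (M : 'M[k]_n.+1) : nat :=
  \max_(j < n.+1 | [exists i : 'I_n.+1, (gl_act M 'X_i - 'X_i)@_U_(j) != 0]) j.+1.

Definition ideal_gen (A : comNzRingType) (X : A -> Prop) (f : A) : Prop :=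
  exists (m : nat) (a x : 'I_m -> A),
    (forall i, X (x i)) /\ f = \sum_(i < m) a i * x i.

Definition is_lform (k : fieldType) (n : nat) (M : 'M[k]_n.+1)
    (l : {mpoly k[n.+1]}) : Prop :=
  [/\ l \is 1.-homog,
      forall f, ideal_gen (fun h => exists s, h = gl_act M s - s) f <->
                ideal_gen (eq l) f
    & exists2 j : 'I_n.+1, j.+1 = beta M & l@_U_(j) = 1].

(* The form l_tau; it exists and is unique when M is a transvection. *)
Definition lform (k : fieldType) (n : nat) (M : 'M[k]_n.+1) : {mpoly k[n.+1]} :=
  epsilon (inhabits 0) (is_lform M).

Definition transvections (k : fieldType) (n : nat) (gT : finGroupType)
    (G : {group gT}) (rG : mx_representation k G n.+1) (N : {set gT}) : {set gT} :=
  [set g in N | transvection (rG g)].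

Definition beta_grp (k : fieldType) (n : nat) (gT : finGroupType)
    (G : {group gT}) (rG : mx_representation k G n.+1) (N : {set gT}) : nat :=
  \max_(g in transvections rG N) beta (rG g).

(* For i = ord0 the sum is empty: the first variable is fixed. *)
Definition unitriangular (k : fieldType) (n : nat) (gT : finGroupType)
    (G : {group gT}) (rG : mx_representation k G n.+1) : Prop :=
  forall (g : gT) (i : 'I_n.+1), g \in G ->
    exists c : 'I_n.+1 -> k,
      gl_act (rG g) 'X_i - 'X_i = \sum_(j < n.+1 | (j < i)%N) c j *: 'X_j.

Definition transvection_series (p : nat) (k : fieldType) (n : nat)
    (gT : finGroupType) (G : {group gT}) (rG : mx_representation k G n.+1)
    (m : nat) (Gs : nat -> {group gT}) : Prop :=
  [/\ Gs 0%N = 1%G, Gs m = G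
    & forall i : nat, (i < m)%N ->
      [/\ Gs i \proper Gs i.+1 /\ (Gs i <| Gs i.+1)%g,
          <<transvections rG (Gs i.+1)>>%g = Gs i.+1,
          (Gs i.+1 / Gs i \isog [set: 'Z_p])%g,
          exists2 t, t \in transvections rG (Gs i.+1)
                   & (Gs i.+1 / Gs i)%g = <[coset (Gs i) t]>%g
        & (beta_grp rG (Gs i) <= beta_grp rG (Gs i.+1))%N]].

Definition penultimate_term (p : nat) (k : fieldType) (n : nat)
    (gT : finGroupType) (G : {group gT}) (rG : mx_representation k G n.+1)
    (G' : {group gT}) : Prop :=
  exists (m : nat) (Gs : nat -> {group gT}),
    transvection_series p rG m.+1 Gs /\ Gs m = G'.

Definition fix_last (k : fieldType) (n : nat) (M : 'M[k]_n.+1) : bool :=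
  [forall i : 'I_n.+1, (i != ord_max) ==> (gl_act M 'X_i == 'X_i)].

Definition Hgrp (k : fieldType) (n : nat) (gT : finGroupType)
    (G : {group gT}) (rG : mx_representation k G n.+1) (N : {set gT}) : {set gT} :=
  <<[set g in transvections rG N | fix_last (rG g)]>>%g.

(* undup: the product is over the orbit as a set. *)
Definition orbit_prod (k : fieldType) (n : nat) (gT : finGroupType)
    (G : {group gT}) (rG : mx_representation k G n.+1) (N : {set gT})
    (f : {mpoly k[n.+1]}) : {mpoly k[n.+1]} :=
  \prod_(s <- undup [seq gl_act (rG h) f | h in N]) s.

Definition is_invariant (k : fieldType) (n : nat) (gT : finGroupType)
    (G : {group gT}) (rG : mx_representation k G n.+1) (N : {set gT})
    (f : {mpoly k[n.+1]}) : Prop :=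
  forall g, g \in N -> gl_act (rG g) f = f.

(* Subrings of S and their fraction fields are predicates on Frac(S), so that
   all the inclusions among them are literal. *)
Definition in_frac (T : idomainType) (A : T -> Prop) (x : {fraction T}) : Prop :=
  exists2 a, A a & x = tofrac a.

Definition frac_field (T : idomainType) (A : T -> Prop) (x : {fraction T}) : Prop :=
  exists a b, [/\ A a, A b, b != 0 & x = tofrac a / tofrac b].

(* e is a K-basis of F, for subfields K of F of a field L. *)
Definition is_basis (L : fieldType) (K F : L -> Prop) (m : nat) (e : 'I_m -> L) : Prop :=
  [/\ forall i, F (e i),
      forall x, F x -> exists2 c : 'I_m -> L,
        forall i, K (c i) & x = \sum_(i < m) c i * e i
    & forall c : 'I_m -> L, (forall i, K (c i)) ->
        \sum_(i < m) c i * e i = 0 -> forall i, c i = 0].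

(* t is the trace of the K-linear endomorphism of F given by multiplication
   by y, computed from its matrix in a K-basis of F. *)
Definition is_trace (L : fieldType) (K F : L -> Prop) (y t : L) : Prop :=
  exists (m : nat) (e : 'I_m -> L) (M : 'M[L]_m),
    [/\ is_basis K F e,
        forall i j, K (M i j),
        forall i, y * e i = \sum_(j < m) M i j * e j
      & t = \tr M].

(* Well defined for y in F when F is finite over K. *)
Definition field_trace (L : fieldType) (K F : L -> Prop) (y : L) : L :=
  epsilon (inhabits 0) (is_trace K F y).

(* The module C = {y in F | Tr_{F/K}(y A) is contained in R}. *)
Definition codifferent (T : idomainType) (A R : T -> Prop) (y : {fraction T}) : Prop :=
  frac_field A y /\
  forall a, A a ->
    in_frac R (field_trace (frac_field R) (frac_field A) (y * tofrac a)).

Definition dedekind_different (T : idomainType) (A R : T -> Prop)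
    (x : {fraction T}) : Prop :=
  frac_field A x /\ forall y, codifferent A R y -> in_frac A (x * y).

Definition homog_generator (k : fieldType) (n : nat)
    (A : {mpoly k[n.+1]} -> Prop) (I : {fraction {mpoly k[n.+1]}} -> Prop)
    (D : {mpoly k[n.+1]}) : Prop :=
  [/\ A D, exists d : nat, D \is d.-homog
    & forall x, I x <-> exists2 a, A a & x = tofrac (a * D)].

Definition eq_upto_scalar (k : fieldType) (n : nat) (f g : {mpoly k[n.+1]}) : Prop :=
  exists2 c : k, c != 0 & f = c *: g.

(* Main.v *)
Require Import Defs.
From mathcomp Require Import all_boot all_order all_fingroup all_algebra.
From mathcomp Require Import pgroup mxrepresentation.
From mathcomp Require Import mpoly.
From HB Require Import structures.
From Stdlib Require Import ClassicalEpsilon.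

(* Write [d g = g x_n - x_n], [l_0 = d sigma], and let [x_r] be the leading variable of
   [l_0].  Elements of [G'] only move by forms in variables below [x_r]; comparing with
   the coset decomposition [g = sigma^i g'], a transvection outside [G'] must fix
   [x_1, ..., x_(n-1)], so that [P \ G' = {sigma^i h | h in H, 0 < i < p}].  Put
   [D = prod_(h in H) (l_0 + d h)]; it is [G]-invariant because [G] permutes the factors
   by conjugation, it equals [(sigma - 1) Pi_H x_n] because [prod_(h in H) (X + d h)] is
   an additive polynomial, and its factors are the [l_tau] up to scalars.  It remains to
   see that the codifferent is generated by [D^-(p-1)].

   - For [a] in [A], [sigma a - a = (sigma h) a - a] is divisible by every [l_0 + d h],
     hence by [D]; so [Tr = (sigma - 1)^(p-1)] maps [A] into [D^(p-1) R].

   - Let [y] be in the codifferent and [f] in [S].  The polynomial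
     [W = prod_(g in G \ G') (T - g f)] has coefficients [w_i] in [A], and
     [sigma^j W] vanishes at [f] for [0 < j < p]; so
     [sum_i f^i Tr (y w_i) = y W(f) = y prod_(g in G \ G') (f - g f)] lies in [S].
     With [f = x_n] this bounds the denominator of [y] by a product of linear forms
     [d g]; with [f = x_n + sum_(j < n) x_j x_1^(2 (j + 1))] the product is
     [c D^(p-1) q] with [c] a nonzero scalar and [q] prime to all those forms.  Hence
     [y D^(p-1)] lies in [S]. *)

Set Implicit Arguments.
Unset Strict Implicit.
Unset Printing Implicit Defensive.

Import GRing.Theory.
Local Open Scope ring_scope.

(** * Field of fractions and traces *)

Section FractionMap.

Variable T : idomainType.

Lemma tofrac_inj : injective (@tofrac T).
Proof. by move=> a b /eqP; rewrite tofrac_eq => /eqP. Qed.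

Lemma fractionP (x : {fraction T}) :
  exists a b : T, b != 0 /\ x = tofrac a / tofrac b.
Proof.
elim/generic_quotient.quotW: x => r.
exists (frac r).1, (frac r).2; split; first exact: denom_ratioP.
apply: (canRL (mulfK _)); first by rewrite tofrac_eq0 denom_ratioP.
unlock tofrac; rewrite !generic_quotient.piE.
apply/eqP; rewrite generic_quotient.eqmodE /= FracField.equivfE /FracField.mulf /=.
by rewrite !numden_Ratio ?oner_eq0 ?mulf_neq0 ?denom_ratioP ?oner_neq0 // !mulr1 mulrC.
Qed.

(** Chosen by [epsilon] because a fraction has many representations; for injective [f] all of them
    give the same value. *)
Definition frac_map (f : T -> T) (x : {fraction T}) : {fraction T} :=
  epsilon (inhabits 0) (fun y =>
    exists a b, [/\ b != 0, x = tofrac a / tofrac b & y = tofrac (f a) / tofrac (f b)]).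

Variable f : {rmorphism T -> T}.
Hypothesis f_inj : injective f.

Lemma frac_map_div a b : b != 0 ->
  frac_map f (tofrac a / tofrac b) = tofrac (f a) / tofrac (f b).
Proof.
move=> b0; rewrite /frac_map.
set P := fun y => _; have := epsilon_spec (inhabits 0) P.
case=> [|a' [b' [b'0 eab ->]]]; first by exists (tofrac (f a) / tofrac (f b)), a, b.
have f0 c : c != 0 -> tofrac (f c) != 0 :> {fraction T}.
  by move=> c0; rewrite tofrac_eq0 -(rmorph0 f) (inj_eq f_inj).
apply/eqP; rewrite eqr_div ?f0 // -!tofracM tofrac_eq -!(rmorphM f) (inj_eq f_inj).
by rewrite -tofrac_eq !tofracM -eqr_div ?tofrac_eq0 // eab.
Qed.

Lemma frac_map_tofrac a : frac_map f (tofrac a) = tofrac (f a).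
Proof.
by have:= frac_map_div a (oner_neq0 T); rewrite (rmorph1 f) !tofrac1 !divr1.
Qed.

Let f0 c : c != 0 -> f c != 0.
Proof. by move=> c0; rewrite -(rmorph0 f) (inj_eq f_inj). Qed.

Lemma frac_mapD x y : frac_map f (x + y) = frac_map f x + frac_map f y.
Proof.
have [a [b [b0 ->]]] := fractionP x; have [c [d [d0 ->]]] := fractionP y.
rewrite addf_div ?tofrac_eq0 // -!tofracM -tofracD !frac_map_div ?mulf_neq0 //.
by rewrite addf_div ?tofrac_eq0 ?f0 // !(rmorphD, rmorphM).
Qed.

Lemma frac_mapM x y : frac_map f (x * y) = frac_map f x * frac_map f y.
Proof.
have [a [b [b0 ->]]] := fractionP x; have [c [d [d0 ->]]] := fractionP y.
rewrite mulf_div -!tofracM !frac_map_div ?mulf_neq0 //.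
by rewrite mulf_div !rmorphM.
Qed.

Lemma frac_map0 : frac_map f 0 = 0.
Proof. by have:= frac_map_tofrac 0; rewrite (rmorph0 f) !tofrac0. Qed.

Lemma frac_map_sum I (r : seq I) (P : pred I) (F : I -> {fraction T}) :
  frac_map f (\sum_(i <- r | P i) F i) = \sum_(i <- r | P i) frac_map f (F i).
Proof. exact: (big_morph _ frac_mapD frac_map0). Qed.

Lemma frac_mapX x n : frac_map f (x ^+ n) = frac_map f x ^+ n.
Proof.
elim: n => [|n IHn]; last by rewrite !exprS frac_mapM IHn.
by rewrite !expr0 -tofrac1 frac_map_tofrac rmorph1.
Qed.

End FractionMap.

(** Two bases are related by matrices with [P Q = 1] and [Q P = 1], and [M P = P M']. Cyclicity of
    the trace concludes without first comparing the sizes [m] and [m']. *)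
Lemma is_trace_uniq (L : fieldType) (K F : L -> Prop) (y t t' : L) :
    K 1 -> (forall a b, K a -> K b -> K (a - b)) ->
    (forall a b, K a -> K b -> K (a * b)) ->
  is_trace K F y t -> is_trace K F y t' -> t = t'.
Proof.
move=> K1 KB KM.
have K0 : K 0 by rewrite -(subrr 1); apply: KB.
have KD a b : K a -> K b -> K (a + b).
  by move=> Ka Kb; rewrite -[b]opprK; apply: (KB) => //; rewrite -sub0r; apply: KB.
have coords m m' (e : 'I_m -> L) (e' : 'I_m' -> L) :
    is_basis K F e -> is_basis K F e' ->
  exists2 P : 'M[L]_(m, m'), forall i j, K (P i j)
                           & forall i, e i = \sum_j P i j * e' j.
  move=> [Fe _ _] [_ span' _].
  have /fin_all_exists[c hc] : forall i : 'I_m, exists ci : 'I_m' -> L,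
      (forall j, K (ci j)) /\ e i = \sum_j ci j * e' j.
    by move=> i; have [ci] := span' _ (Fe i); exists ci.
  exists (\matrix_(i, j) c i j) => [i j|i]; first by rewrite mxE; have [] := hc i.
  by have [_ ->] := hc i; apply: eq_bigr => j _; rewrite mxE.
have mulE m m' m'' (e : 'I_m'' -> L) (B : 'M[L]_(m, m')) (C : 'M_(m', m'')) i :
    \sum_j B i j * (\sum_l C j l * e l) = \sum_l (B *m C) i l * e l.
  under eq_bigr do rewrite mulr_sumr; rewrite exchange_big; apply: eq_bigr => l _.
  by rewrite mxE mulr_suml; apply: eq_bigr => j _; rewrite mulrA.
have mx_inj m m' (e : 'I_m' -> L) (B C : 'M[L]_(m, m')) :
    is_basis K F e -> (forall i j, K (B i j)) -> (forall i j, K (C i j)) ->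
    (forall i, \sum_j B i j * e j = \sum_j C i j * e j) -> B = C.
  move=> [_ _ free] KBm KC eBC; apply/matrixP => i j; apply/eqP; rewrite -subr_eq0.
  apply/eqP; apply: (free (fun j => B i j - C i j)) => [l|]; first exact: KB.
  by under eq_bigr do rewrite mulrBl; rewrite sumrB eBC subrr.
have KmxM m m' m'' (B : 'M[L]_(m, m')) (C : 'M_(m', m'')) :
    (forall i j, K (B i j)) -> (forall i j, K (C i j)) -> forall i j, K ((B *m C) i j).
  by move=> KBm KC i j; rewrite mxE; elim/big_ind: _ => // l _; apply: KM.
move=> [m [e [M [be KMm eM ->]]]] [m' [e' [M' [be' KM' eM' ->]]]].
have [P KP eP] := coords _ _ _ _ be be'.
have [Q KQ eQ] := coords _ _ _ _ be' be.
have QP1 : Q *m P = 1%:M.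
  apply: (mx_inj _ _ e') => //; first exact: KmxM.
    by move=> i j; rewrite mxE; case: (i == j).
  move=> i; rewrite -mulE -[in LHS](eq_bigr _ (fun j _ => congr1 (fun x => Q i j * x) (eP j))).
  rewrite -eQ (bigD1 i) //= mxE eqxx mul1r big1 ?addr0 // => j /negPf ji.
  by rewrite mxE eq_sym ji mul0r.
have PQ1 : P *m Q = 1%:M.
  apply: (mx_inj _ _ e) => //; first exact: KmxM.
    by move=> i j; rewrite mxE; case: (i == j).
  move=> i; rewrite -mulE -[in LHS](eq_bigr _ (fun j _ => congr1 (fun x => P i j * x) (eQ j))).
  rewrite -eP (bigD1 i) //= mxE eqxx mul1r big1 ?addr0 // => j /negPf ji.
  by rewrite mxE eq_sym ji mul0r.
have MP : M *m P = P *m M'.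
  apply: (mx_inj _ _ e') => //; try exact: KmxM.
  move=> i; rewrite -!mulE.
  under eq_bigr do rewrite -eP; under [RHS]eq_bigr do rewrite -eM'.
  by rewrite -eM eP mulr_sumr; apply: eq_bigr => j _; rewrite mulrCA.
by rewrite -[M]mulmx1 -PQ1 mulmxA MP mxtrace_mulC mulmxA QP1 mul1mx.
Qed.

(** Bezout gives [m j = r p + 1], so [s ^+ (m * j)] is [s] times a power of [s ^+ p]. *)
Lemma mem_of_prime_expg (gT : finGroupType) (M : {group gT}) (s : gT) (j p : nat) :
  prime p -> (0 < j < p)%N -> (s ^+ j)%g \in M -> (s ^+ p)%g \in M -> s \in M.
Proof.
move=> p_pr /andP[j0 jp] sj sp.
have co : coprime j p by rewrite coprime_sym prime_coprime // gtnNdvd.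
have [m r e _] := egcdnP p j0; move: e; rewrite (eqP co) => e.
have : (s ^+ (m * j))%g \in M by rewrite mulnC expgM groupX.
by rewrite e expgD expg1 mulnC expgM groupMl // groupX.
Qed.

(** * Trace and codifferent for a normal subgroup with quotient of order [p] *)

Section CyclicQuotient.

Variables (T : idomainType) (gT : finGroupType) (act : gT -> {rmorphism T -> T}).
Variables (G N : {group gT}) (s : gT) (p : nat).

Hypothesis act1 : act 1%g =1 id.
Hypothesis actM : forall g h, g \in G -> h \in G ->
  forall x, act (g * h)%g x = act g (act h x).
Hypotheses (p_pr : prime p) (nNG : (N <| G)%g) (sG : s \in G) (sN : s \notin N).
Hypothesis spN : (s ^+ p)%g \in N.
Hypothesis cosetG : forall g, g \in G -> exists j : 'I_p, ((s ^+ j)^-1 * g)%g \in N.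

Definition invariants (M : {set gT}) (x : T) : Prop := forall g, g \in M -> act g x = x.

Local Notation A := (invariants N).
Local Notation R := (invariants G).
Local Notation fact g := (frac_map (act g)).

Let NG g : g \in N -> g \in G.
Proof. by move: g; apply/subsetP/normal_sub. Qed.

Let sXG j : (s ^+ j)%g \in G. Proof. exact: groupX. Qed.

Lemma act_injective g : g \in G -> injective (act g).
Proof.
move=> gG x y /(congr1 (act g^-1%g)).
by rewrite -!actM ?groupV // mulVg !act1.
Qed.

Lemma act_expg g m x : g \in G -> act (g ^+ m)%g x = iter m (act g) x.
Proof.
by move=> gG; elim: m => [|m IHm]; rewrite ?expg0 ?act1 // expgS actM ?groupX // IHm.
Qed.

Lemma fact1 x : fact 1%g x = x.
Proof.
have [a [b [b0 ->]]] := fractionP x.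
by rewrite frac_map_div //; [rewrite !act1 | exact/act_injective/group1].
Qed.

Lemma factM g h x : g \in G -> h \in G -> fact (g * h)%g x = fact g (fact h x).
Proof.
move=> gG hG; have [a [b [b0 ->]]] := fractionP x.
have hb0 : act h b != 0 by rewrite -(rmorph0 (act h)) (inj_eq (act_injective hG)).
rewrite !frac_map_div //; (try exact/act_injective/groupM); try exact: act_injective.
by rewrite !actM.
Qed.

Lemma frac_field_fact (M : {group gT}) x : M \subset G ->
  frac_field (invariants M) x -> forall g, g \in M -> fact g x = x.
Proof.
move=> /subsetP MG [a [b [Ma Mb b0 ->]]] g gM.
by rewrite frac_map_div ?Ma ?Mb //; apply/act_injective/MG.
Qed.

(** The denominator is replaced by the product [b'] of the conjugates of [b], which is invariant;
    the new numerator [a' = x b'] is then invariant too. *)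
Lemma fact_frac_field (M : {group gT}) x : M \subset G ->
  (forall g, g \in M -> fact g x = x) -> frac_field (invariants M) x.
Proof.
move=> /subsetP MG fx; have [a [b [b0 ex]]] := fractionP x.
pose b' := \prod_(g in M) act g b.
have b'0 : b' != 0.
  apply/prodf_neq0 => g gM.
  by rewrite -(rmorph0 (act g)) (inj_eq (act_injective (MG _ gM))).
have invb' : invariants M b'.
  move=> h hM; rewrite rmorph_prod (reindex_inj (mulgI h^-1%g)) /=.
  apply: eq_big => [g|g gM]; first by rewrite groupMl ?groupV.
  rewrite groupMl ?groupV // in gM.
  by rewrite -actM ?groupM ?groupV ?MG // mulKVg.
pose a' := a * \prod_(g in M | g != 1%g) act g b.
have xb' : x * tofrac b' = tofrac a'.
  rewrite ex /b' (bigD1 1%g) //= act1 tofracM mulrA divfK ?tofrac_eq0 //.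
  by rewrite -tofracM.
exists a', b'; split=> //; last by rewrite -xb' mulfK ?tofrac_eq0.
move=> g gM; apply: tofrac_inj; have gi := act_injective (MG _ gM).
by rewrite -frac_map_tofrac // -xb' frac_mapM // fx // frac_map_tofrac // invb'.
Qed.

Lemma fact_coset g : g \in G -> exists j : 'I_p, forall x, frac_field A x ->
  fact g x = fact (s ^+ j)%g x.
Proof.
move=> gG; have [j gj] := cosetG gG; exists j => x Fx.
rewrite -[g in LHS](mulKVg (s ^+ j)%g) factM ?groupM ?groupV //.
by rewrite (frac_field_fact (normal_sub nNG) Fx).
Qed.

Lemma expg_notin (j : nat) : (0 < j < p)%N -> (s ^+ j)%g \notin N.
Proof.
move=> jp; apply: contra sN => sjN; exact: mem_of_prime_expg p_pr jp sjN spN.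
Qed.

(** The stabilizer of [a] contains [s ^+ p], which lies in [N]. A coincidence at [i < j] would put
    [s ^+ (j - i)] into it, hence [s] itself. *)
Lemma invariant_powers_inj a : A a -> act s a != a ->
  injective (fun j : 'I_p => act (s ^+ j)%g a).
Proof.
move=> Aa sa.
have fixG : group_set [set g in G | act g a == a].
  apply/group_setP; split=> [|g h]; first by rewrite !inE group1 act1 eqxx.
  rewrite !inE => /andP[gG /eqP ga] /andP[hG /eqP ha].
  by rewrite groupM // actM // ha ga eqxx.
have lt_inj (i j : 'I_p) : (i < j)%N -> act (s ^+ i)%g a != act (s ^+ j)%g a.
  move=> ij; apply/eqP => eij; case/negP: sa.
  have : s \in Group fixG.
    apply: (@mem_of_prime_expg _ _ _ (j - i) _ p_pr); rewrite ?inE /=.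
    - by rewrite subn_gt0 ij (leq_ltn_trans _ (ltn_ord j)) ?leq_subr.
    - rewrite groupX //=; apply/eqP/(act_injective (sXG i)).
      by rewrite -actM // -expgD subnKC ?(ltnW ij).
    by rewrite groupX //= Aa.
  by rewrite inE => /andP[].
move=> i j eij; apply: val_inj; case: (ltngtP i j) => // lt.
  by have := lt_inj _ _ lt; rewrite eij eqxx.
by have := lt_inj _ _ lt; rewrite eij eqxx.
Qed.

Section PowerBasis.

Variable a : T.
Hypotheses (Aa : A a) (sa : act s a != a).

Let e (i : 'I_p) : {fraction T} := tofrac a ^+ i.
(** Column [j] holds the images of [1, a, ..., a^(p-1)] under [s ^+ j]; the determinant is nonzero
    because the conjugates of [a] are distinct. *)
Let E : 'M[{fraction T}]_p := Vandermonde p (\row_j tofrac (act (s ^+ j)%g a)).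

Let EE i j : E i j = fact (s ^+ j)%g (e i).
Proof.
rewrite !mxE frac_mapX; last exact: act_injective.
by rewrite frac_map_tofrac //; apply: act_injective.
Qed.

Let unitE : E \in unitmx.
Proof.
rewrite unitmxE unitfE det_Vandermonde; apply/prodf_neq0 => i _.
apply/prodf_neq0 => j ij; rewrite !mxE subr_eq0 tofrac_eq.
by apply: contraTneq ij => /(invariant_powers_inj Aa sa) ->; rewrite ltnn.
Qed.

Let Fe i : frac_field A (e i).
Proof.
exists (a ^+ i), 1; split; rewrite ?oner_eq0 ?tofrac1 ?divr1 ?tofracXn //.
  by move=> g gN; rewrite rmorphXn Aa.
by move=> g gN; rewrite rmorph1.
Qed.

(** The coordinates solve [c *m E = r], where [r] lists the conjugates of [x]. Each [g] in [G]
    permutes these equations, so uniqueness of the solution makes every coordinate [G]-invariant. *)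
Let span x : frac_field A x -> exists2 c : 'I_p -> {fraction T},
  forall i, frac_field R (c i) & x = \sum_i c i * e i.
Proof.
move=> Fx; pose r : 'rV_p := \row_j fact (s ^+ j)%g x.
pose c := r *m invmx E.
have rE : c *m E = r by rewrite mulmxKV.
have xc : x = \sum_i c 0 i * e i.
  have p0 := prime_gt0 p_pr.
  move/rowP/(_ (Ordinal p0)): (rE); rewrite !mxE /= expg0 fact1 => <-.
  by apply: eq_bigr => i _; rewrite EE expg0 fact1.
exists (fun i => c 0 i) => // i; apply: fact_frac_field => // g gG.
suff : map_mx (fact g) c *m E = r.
  by move/(canRL (mulmxK unitE)) => /rowP/(_ i); rewrite mxE.
apply/rowP => j'.
(* The equation numbered [j'] is the image under [g] of the one numbered [j]. *)
have [j hj] : exists j : 'I_p, forall y, frac_field A y ->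
    fact (g * s ^+ j)%g y = fact (s ^+ j')%g y.
  have gsG : (g^-1 * s ^+ j')%g \in G by rewrite groupM ?groupV.
  have [j hj] := fact_coset gsG; exists j => y Fy.
  by rewrite factM // -hj // -factM // mulKVg.
rewrite !mxE -hj // factM //.
have -> : fact (s ^+ j)%g x = r 0 j by rewrite mxE.
rewrite -rE mxE frac_map_sum; last exact: act_injective.
apply: eq_bigr => l _; rewrite frac_mapM; last exact: act_injective.
by rewrite mxE !EE -factM // hj.
Qed.

Let basis : is_basis (frac_field R) (frac_field A) e.
Proof.
split=> // c Kc c0 i.
suff : (\row_i c i) *m E = 0.
  by move/(canRL (mulmxK unitE)); rewrite mul0mx => /rowP/(_ i); rewrite !mxE.
apply/rowP => j; rewrite [RHS]mxE; have := congr1 (fact (s ^+ j)%g) c0.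
rewrite frac_map0 ?frac_map_sum; try exact: act_injective.
move=> <-; rewrite [LHS]mxE.
apply: eq_bigr => l _; rewrite frac_mapM; last exact: act_injective.
by rewrite EE mxE (frac_field_fact _ (Kc l)).
Qed.

(** [E] diagonalizes the matrix [B] of multiplication by [y], and the diagonal entries are the
    conjugates of [y]. *)
Lemma is_trace_sum y : frac_field A y ->
  is_trace (frac_field R) (frac_field A) y (\sum_(j < p) fact (s ^+ j)%g y).
Proof.
move=> Fy.
have /fin_all_exists[M hM] : forall i : 'I_p, exists c : 'I_p -> {fraction T},
    (forall j, frac_field R (c j)) /\ y * e i = \sum_j c j * e j.
  move=> i; have [|c] := @span (y * e i); last by exists c.
  apply: fact_frac_field => [|g gN]; first exact: normal_sub.
  rewrite frac_mapM; last exact/act_injective/NG.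
  by rewrite !(frac_field_fact (normal_sub nNG)).
pose B : 'M[{fraction T}]_p := \matrix_(i, j) M i j.
exists p, e, B; split=> // [i j|i|].
- by rewrite mxE; have [] := hM i.
- by have [_ ->] := hM i; apply: eq_bigr => j _; rewrite mxE.
have BE : B *m E = E *m diag_mx (\row_j fact (s ^+ j)%g y).
  apply/matrixP => i j; rewrite mul_mx_diag [LHS]mxE [RHS]mxE EE [X in _ * X]mxE mulrC.
  rewrite -frac_mapM; last exact: act_injective.
  have [KM ->] := hM i; rewrite frac_map_sum; last exact: act_injective.
  apply: eq_bigr => l _; rewrite frac_mapM ?EE; last exact: act_injective.
  by rewrite mxE (frac_field_fact _ (KM l)).
rewrite -[B](mulmxK unitE) BE mxtrace_mulC mulKmx // mxtrace_diag.
by apply: eq_bigr => j _; rewrite mxE.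
Qed.

End PowerBasis.

Lemma field_traceE a y : A a -> act s a != a -> frac_field A y ->
  field_trace (frac_field R) (frac_field A) y = \sum_(j < p) fact (s ^+ j)%g y.
Proof.
move=> Aa sa Fy; have tr := is_trace_sum Aa sa Fy.
apply: is_trace_uniq (epsilon_spec _ _ (ex_intro _ _ tr)) tr.
- apply: fact_frac_field => // g gG.
  by rewrite -tofrac1 frac_map_tofrac ?rmorph1 //; apply: act_injective.
- move=> x z Rx Rz; apply: fact_frac_field => // g gG.
  rewrite -[- z]mulN1r frac_mapD ?frac_mapM; try exact: act_injective.
  rewrite -tofrac1 -tofracN frac_map_tofrac; last exact: act_injective.
  by rewrite rmorphN rmorph1 !(frac_field_fact (subxx _)).
move=> x z Rx Rz; apply: fact_frac_field => // g gG.
by rewrite frac_mapM ?(frac_field_fact (subxx _)) //; apply: act_injective.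
Qed.

(* The coefficients of [W] are [N]-invariant, and [s ^+ j] turns the value of [W] at
   [x] into 0 unless [j = 0], because [s ^- j] then lies in [G :\: N]. *)
Let W (x : T) : {poly T} := \prod_(g in G :\: N) ('X - (act g x)%:P).

Let horner_actW x g : g \in G -> (map_poly (act g) (W x)).[x]
  = \prod_(h in G :\: N) (x - act (g * h)%g x).
Proof.
move=> gG; rewrite rmorph_prod horner_prod; apply: eq_bigr => h.
rewrite !inE => /andP[_ hG].
by rewrite rmorphB /= map_polyX map_polyC /= hornerXsubC actM.
Qed.

Let W_invariant x i : A (W x)`_i.
Proof.
move=> h hN; rewrite -coef_map; congr ((polyseq _)`_i); rewrite rmorph_prod /W.
rewrite [RHS](reindex_inj (mulgI h)) /=; apply: eq_big => [g|g].
  by rewrite !inE !groupMl // NG.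
rewrite !inE => /andP[_ gG].
by rewrite rmorphB /= map_polyX map_polyC /= actM // NG.
Qed.

Let horner_act_coef x g :
  (map_poly (act g) (W x)).[x] = \sum_(i < size (W x)) act g (W x)`_i * x ^+ i.
Proof.
rewrite (@horner_coef_wide _ (size (W x))); last exact: size_poly.
by apply: eq_bigr => i _; rewrite coef_map.
Qed.

(** If [s] fixed all coefficients of [W x], then [W x] and its image under [s] would agree at [x].
    The image vanishes there through the factor of [s^-1], while [W x] has only nonzero factors. *)
Lemma exists_moved_invariant x : (forall g, g \in G -> g \notin N -> act g x != x) ->
  exists2 a, A a & act s a != a.
Proof.
move=> mvx.
suff /existsP[i Wi] : [exists i : 'I_(size (W x)), act s (W x)`_i != (W x)`_i].
  by exists (W x)`_i.
apply: contraT; rewrite negb_exists => /forallP fixW.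
have : (map_poly (act s) (W x)).[x] = (map_poly (act 1%g) (W x)).[x].
  rewrite !horner_act_coef; apply: eq_bigr => i _.
  by rewrite act1; have:= fixW i; rewrite negbK => /eqP ->.
rewrite !horner_actW // [LHS](bigD1 s^-1%g) /=; last by rewrite !inE !groupV sN.
rewrite mulgV act1 subrr mul0r => /esym/eqP/prodf_eq0[g].
rewrite !inE => /andP[gN gG]; rewrite mul1g subr_eq0 => /eqP ex.
by have := mvx _ gG gN; rewrite -ex eqxx.
Qed.

Lemma codifferent_mul_prod a y x : A a -> act s a != a -> codifferent A R y ->
  exists z, y * tofrac (\prod_(g in G :\: N) (x - act g x)) = tofrac z.
Proof.
move=> Aa sa [Fy Cy].
have /fin_all_exists[r hr] : forall i : 'I_(size (W x)), exists r : T,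
    \sum_(j < p) fact (s ^+ j)%g (y * tofrac (W x)`_i) = tofrac r.
  move=> i; rewrite -(field_traceE Aa sa).
    by have [r _ ->] := Cy _ (W_invariant x i); exists r.
  apply: fact_frac_field => [|g gN]; first exact: normal_sub.
  have gi := act_injective (NG gN).
  rewrite frac_mapM // (frac_field_fact (normal_sub nNG) Fy) //.
  by rewrite frac_map_tofrac // W_invariant.
exists (\sum_i r i * x ^+ i).
rewrite rmorph_sum /=; under [RHS]eq_bigr do rewrite tofracM -hr mulr_suml.
(* After the exchange, the inner sum for [j] is the conjugate of [y] times the value at [x] of the
   image of [W x] under [s ^+ j]; only [j = 0] survives. *)
rewrite exchange_big /= (bigD1 (Ordinal (prime_gt0 p_pr))) //= [X in _ = _ + X]big1 ?addr0.
  under [RHS]eq_bigr do rewrite expg0 fact1 -mulrA -tofracM.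
  rewrite -mulr_sumr -rmorph_sum; congr (_ * tofrac _).
  have := horner_act_coef x 1%g; rewrite horner_actW ?group1 // => eW.
  under eq_bigr => g _ do rewrite -[g in act g](mul1g g).
  by rewrite eW; apply: eq_bigr => i _; rewrite act1.
move=> j j0; have sji := act_injective (sXG j).
under eq_bigr do rewrite frac_mapM // frac_map_tofrac // -mulrA -tofracM.
rewrite -mulr_sumr -rmorph_sum -horner_act_coef horner_actW //.
rewrite (bigD1 (s ^- j)%g) /=; last first.
  rewrite !inE !groupV sXG expg_notin // ltn_ord andbT lt0n.
  by apply: contra j0 => /eqP j0; apply/eqP/val_inj.
by rewrite mulgV act1 subrr mul0r tofrac0 mulr0.
Qed.

End CyclicQuotient.

(** * Linear forms *)

Section LinearForms.

Variables (k : fieldType) (n : nat).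
Local Notation S := {mpoly k[n.+1]}.
Implicit Types (M : 'M[k]_n.+1) (u v : 'cV[k]_n.+1) (f g l : S) (i j : 'I_n.+1).

Definition lin v : S := \sum_j v j 0 *: 'X_j.

Lemma lin_is_linear : linear lin.
Proof.
move=> c u v; rewrite /lin scaler_sumr -big_split; apply: eq_bigr => j _ /=.
by rewrite !mxE scalerDl scalerA.
Qed.
HB.instance Definition _ := GRing.isLinear.Build k 'cV[k]_n.+1 S _ lin lin_is_linear.

Lemma mcoeff_lin v j : (lin v)@_U_(j) = v j 0.
Proof.
rewrite raddf_sum /= (bigD1 j) //= mcoeffZ mcoeffXU eqxx mulr1.
rewrite big1 ?addr0 // => i /negPf ij.
by rewrite mcoeffZ mcoeffXU ij mulr0.
Qed.

Lemma lin_inj : injective lin.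
Proof.
by move=> u v e; apply/colP => j; rewrite -!mcoeff_lin e.
Qed.

Lemma lin_eq0 v : (lin v == 0) = (v == 0).
Proof. by rewrite -(inj_eq lin_inj) linear0. Qed.

Lemma lin_delta i : 'X_i = lin (delta_mx i 0).
Proof.
rewrite /lin (bigD1 i) //= mxE !eqxx scale1r big1 ?addr0 // => j /negPf ji.
by rewrite mxE ji scale0r.
Qed.

Lemma lin_homog v : lin v \is 1.-homog.
Proof. by apply: rpred_sum => j _; apply: rpredZ; rewrite dhomogX; apply/eqP/mdeg1. Qed.

HB.instance Definition _ M := GRing.RMorphism.copy (@gl_act k n M)
  (comp_mpoly [tuple \sum_(j < n.+1) M j i *: 'X_j | i < n.+1]).

Lemma gl_actZ M c f : gl_act M (c *: f) = c *: gl_act M f.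
Proof. exact: comp_mpolyZ. Qed.

Lemma gl_actX M i : gl_act M 'X_i = lin (col i M).
Proof.
rewrite /gl_act comp_mpolyXU -tnth_nth tnth_mktuple.
by apply: eq_bigr => j _; rewrite mxE.
Qed.

Lemma gl_act_lin M v : gl_act M (lin v) = lin (M *m v).
Proof.
rewrite rmorph_sum /=; under eq_bigr do rewrite gl_actZ gl_actX -linearZ.
rewrite -linear_sum; congr lin; apply/colP => i; rewrite summxE mxE.
by apply: eq_bigr => j _; rewrite !mxE mulrC.
Qed.

Lemma eq_mpoly_rmorph (U : comNzRingType) (f1 f2 : {rmorphism S -> U}) :
  (forall c, f1 c%:MP = f2 c%:MP) -> (forall i, f1 'X_i = f2 'X_i) -> f1 =1 f2.
Proof.
move=> eC eX f; rewrite [f]mpolyE !rmorph_sum; apply: eq_bigr => m _ /=.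
rewrite -mul_mpolyC !rmorphM eC mpolyXE_id !rmorph_prod; congr (_ * _).
by apply: eq_bigr => i _; rewrite !rmorphXn eX.
Qed.

Lemma gl_act_mulmx M N f : gl_act (M *m N) f = gl_act M (gl_act N f).
Proof.
apply: (@eq_mpoly_rmorph _ (gl_act (M *m N)) (gl_act M \o gl_act N)) => [c|i] /=.
  by rewrite /gl_act !comp_mpolyC.
by rewrite !gl_actX gl_act_lin !colE mulmxA.
Qed.

Lemma gl_act1 f : gl_act 1%:M f = f.
Proof.
apply: (@eq_mpoly_rmorph _ (gl_act 1%:M) idfun) => [c|i] /=.
  by rewrite /gl_act comp_mpolyC.
by rewrite gl_actX colE mul1mx lin_delta.
Qed.

Definition divides l f : Prop := exists q, f = q * l.

Lemma dividesD l f g : divides l f -> divides l g -> divides l (f + g).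
Proof. by move=> [q ->] [r ->]; exists (q + r); rewrite mulrDl. Qed.

Lemma dividesMl l f g : divides l f -> divides l (g * f).
Proof. by move=> [q ->]; exists (g * q); rewrite mulrA. Qed.

(** The action of [M] and the identity agree modulo [l] on the variables, hence on sums and products
    of them. *)
Lemma gl_act_divides l M : (forall i, divides l (gl_act M 'X_i - 'X_i)) ->
  forall f, divides l (gl_act M f - f).
Proof.
move=> dX.
have d0 : divides l 0 by exists 0; rewrite mul0r.
have dM a b a' b' : divides l (a - a') -> divides l (b - b') -> divides l (a * b - a' * b').
  move=> da db; have -> : a * b - a' * b' = b * (a - a') + a' * (b - b').
    by rewrite !mulrBr ![b * _]mulrC addrA subrK.
  by apply: dividesD; apply: dividesMl.
move=> f; rewrite [f]mpolyE rmorph_sum -sumrB.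
elim/big_ind: _ => [//|a b|m _ /=]; first exact: dividesD.
rewrite gl_actZ -scalerBr -mul_mpolyC; apply: dividesMl.
rewrite mpolyXE_id rmorph_prod.
elim/big_ind2: _ => [||i _] /=; first by rewrite subrr.
  by move=> *; apply: dM.
elim: (m i) => [|e IHe]; first by rewrite !expr0 rmorph1 subrr.
by rewrite exprS rmorphM; apply: dM; [exact: dX | exact: IHe].
Qed.

Definition kill_mx v j : 'M[k]_n.+1 := 1%:M - (v j 0)^-1 *: (v *m delta_mx 0 j).

Lemma kill_mxE v j u : kill_mx v j *m u = u - (u j 0 / v j 0) *: v.
Proof.
rewrite mulmxBl mul1mx -scalemxAl -mulmxA -rowE; congr (_ - _).
rewrite [row j u]mx11_scalar mul_mx_scalar scalerA mxE.
by rewrite mulrC.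
Qed.

(* The substitution [x_j := x_j - v / v_j] has kernel exactly the ideal (v). *)
Lemma dividesP v j f : v j 0 != 0 ->
  divides (lin v) f <-> gl_act (kill_mx v j) f = 0.
Proof.
move=> vj; split=> [[q ->]|f0].
  by rewrite rmorphM /= gl_act_lin kill_mxE divff // scale1r subrr linear0 mulr0.
suff [q] : divides (lin v) (gl_act (kill_mx v j) f - f).
  by rewrite f0 sub0r => /eqP; rewrite eqr_oppLR -mulNr => /eqP ->; exists (- q).
apply: gl_act_divides => i; rewrite lin_delta gl_act_lin kill_mxE.
rewrite linearB addrC addKr linearZ -scaleNr.
exists (- ((delta_mx i 0 : 'cV[k]_n.+1) j 0 / v j 0))%:MP.
by rewrite mul_mpolyC.
Qed.

(** The ideal of [lin v] is the kernel of an endomorphism of a domain, hence prime. *)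
Lemma lin_prime v f g : v != 0 ->
  divides (lin v) (f * g) -> ~ divides (lin v) g -> divides (lin v) f.
Proof.
move=> /cV0Pn[j vj]; rewrite !(dividesP _ vj) rmorphM => /eqP.
by rewrite mulf_eq0 => /orP[/eqP|/eqP ->].
Qed.

(** The forms are primes, none dividing another: after one is split off, the remaining ones still
    divide the quotient. *)
Lemma prod_lin_divides (I : eqType) (r : seq I) (v : I -> 'cV[k]_n.+1) f : uniq r ->
  {in r, forall x, v x != 0} ->
  {in r &, forall x y, x != y -> ~ divides (lin (v x)) (lin (v y))} ->
  {in r, forall x, divides (lin (v x)) f} ->
  divides (\prod_(x <- r) lin (v x)) f.
Proof.
elim: r f => [|x r IHr] f /=; first by exists f; rewrite big_nil mulr1.
move=> /andP[xr ur] v0 co df; have [q ef] := df x (mem_head _ _).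
have rs y : y \in r -> y \in x :: r by rewrite inE orbC => ->.
have [q' eq] : divides (\prod_(x <- r) lin (v x)) q.
  apply: IHr => // [y yr|y z yr zr|y yr]; first exact/v0/rs.
    by apply: co; apply: rs.
  apply: (@lin_prime _ q (lin (v x))); first exact/v0/rs.
    by rewrite -ef; apply/df/rs.
  apply: co; rewrite ?mem_head ?rs //.
  by apply: contraNneq xr => <-.
by exists q'; rewrite big_cons ef eq mulrAC mulrA.
Qed.

(** Repeated forms are allowed: each is prime and does not divide [g], so it is split off from [f]
    and cancelled in turn. *)
Lemma prod_lin_divides_cancel (I : eqType) (r : seq I) (v : I -> 'cV[k]_n.+1) f g :
  {in r, forall x, v x != 0} -> {in r, forall x, ~ divides (lin (v x)) g} ->
  divides (\prod_(x <- r) lin (v x)) (f * g) -> divides (\prod_(x <- r) lin (v x)) f.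
Proof.
elim: r f => [|x r IHr] f v0 ndg; first by exists f; rewrite big_nil mulr1.
have rs y : y \in r -> y \in x :: r by rewrite inE orbC => ->.
rewrite big_cons => -[q efg].
have [f' ef] : divides (lin (v x)) f.
  apply: lin_prime (ndg x (mem_head _ _)); first exact/v0/mem_head.
  by rewrite efg; exists (q * \prod_(x <- r) lin (v x)); rewrite mulrAC mulrA.
have [q' ef'] : divides (\prod_(x <- r) lin (v x)) f'.
  apply: IHr => [y /rs/v0 //|y /rs/ndg //|].
  exists q; apply: (mulIf (x := lin (v x))); first by rewrite lin_eq0 v0 ?mem_head.
  by rewrite mulrAC -ef efg mulrAC mulrA.
by exists q'; rewrite ef ef' mulrAC mulrA.
Qed.

Lemma mcoeff_gl_actX M i j : (gl_act M 'X_i - 'X_i)@_U_(j) = (M - 1) j i.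
Proof. by rewrite gl_actX lin_delta -linearB mcoeff_lin !mxE andbT. Qed.

End LinearForms.

(** * The leading index [beta], and transvections as perturbations of the identity of rank one *)

Lemma beta_attained (k : fieldType) n (M : 'M[k]_n.+1) : (0 < beta M)%N ->
  exists2 j : 'I_n.+1, j.+1 = beta M & exists i, (M - 1) j i != 0.
Proof.
pose P := [pred j : 'I_n.+1 | [exists i : 'I_n.+1, (gl_act M 'X_i - 'X_i)@_U_(j) != 0]].
rewrite /beta.
have [P0|/card_gt0P [j0 Pj0] _] := posnP #|P|.
  by rewrite big_pred0 // => j; exact: (card0_eq P0 j).
have [|j Pj ->] := @eq_bigmax_cond _ P (fun j : 'I_n.+1 => j.+1).
  by apply/card_gt0P; exists j0.
exists j => //; have /existsP[i] : P j by [].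
by rewrite mcoeff_gl_actX; exists i.
Qed.

Lemma leq_beta (k : fieldType) n (M : 'M[k]_n.+1) i j : (M - 1) j i != 0 -> (j < beta M)%N.
Proof.
move=> Mji; apply: (leq_bigmax_cond (F := fun j : 'I_n.+1 => j.+1)).
by apply/existsP; exists i; rewrite mcoeff_gl_actX.
Qed.

Lemma beta_eq (k : fieldType) n (M : 'M[k]_n.+1) i j : (M - 1) j i != 0 ->
  (forall j' i' : 'I_n.+1, (j < j')%N -> (M - 1) j' i' = 0) -> beta M = j.+1.
Proof.
move=> Mji M0; apply/eqP; rewrite eqn_leq (leq_beta Mji) andbT.
apply/bigmax_leqP => j' /existsP[i']; rewrite mcoeff_gl_actX.
by apply: contraR; rewrite ltnS -ltnNge => jj'; rewrite M0.
Qed.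

(** A fixed space of dimension [n] in dimension [n + 1] means that [M - 1] has rank 1; column and
    row bases give the factors. *)
Lemma transvection_factor (k : fieldType) n (M : 'M[k]_n.+1) : transvection M ->
  exists (a : 'cV[k]_n.+1) (phi : 'rV[k]_n.+1), M - 1 = a *m phi.
Proof.
move=> /andP[/eqP rk _].
have rk1 : \rank (M - 1) = 1%N.
  move: rk; rewrite /eigenspace mxrank_ker.
  have -> : M^T - 1%:M = (M - 1)^T by rewrite linearB /= trmx1.
  rewrite mxrank_tr => e.
  by rewrite -(subKn (rank_leq_row (M - 1))) e subSnn.
have := mulmx_base (M - 1).
by move: (col_base _) (row_base _); rewrite rk1 => a phi <-; exists a, phi.
Qed.

Lemma rank1_transvection (k : fieldType) n (M : 'M[k]_n.+1)
    (a : 'cV[k]_n.+1) (phi : 'rV[k]_n.+1) :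
  M - 1 = a *m phi -> a != 0 -> phi != 0 -> phi *m a = 0 -> transvection M.
Proof.
move=> eM a0 phi0 phia.
have rk1 : \rank (M - 1) = 1%N.
  apply/eqP; rewrite eqn_leq eM (leq_trans (mxrankM_maxl _ _)) ?rank_leq_col //.
  rewrite lt0n mxrank_eq0; have /cV0Pn[j aj] := a0; have /rV0Pn[i phii] := phi0.
  apply/eqP => /matrixP/(_ j i)/eqP; rewrite !mxE big_ord1 mulf_eq0.
  by rewrite (negPf aj) (negPf phii).
apply/andP; split; last first.
  by rewrite expr2 /GRing.mul /= eM mulmxA -(mulmxA a) phia mulmx0 mul0mx.
rewrite /pseudo_reflection /eigenspace mxrank_ker.
have -> : M^T - 1%:M = (M - 1)^T by rewrite linearB /= trmx1.
by rewrite mxrank_tr rk1 subn1.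
Qed.

(** * Iterated differences and additive polynomials *)

Section IteratedDifference.

Variables (T : comNzRingType) (f : {rmorphism T -> T}) (D : T) (d : nat -> T).
Hypotheses (fD : f D = D) (fd : forall i, f (d i) = d i + D * d i.+1).

(** Newton's forward difference formula: [f] acts as [1 + D * shift] on the sequence [d]. Any bound
    [m > j] works since the binomials beyond [j] vanish, so different [j] can share one range. *)
Lemma iter_difference j m i : (j < m)%N ->
  iter j f (d i) = \sum_(l < m) D ^+ l * d (i + l)%N *+ 'C(j, l).
Proof.
elim: j m i => [|j IHj] m i; case: m => // m jm.
  by rewrite big_ord_recl bin0 mulr1n expr0 mul1r addn0 big1 ?addr0.
have iterD x y : iter j f (x + y) = iter j f x + iter j f y.
  by elim: (j) => //= j' ->; rewrite rmorphD.
have iterDM x : iter j f (D * x) = D * iter j f x.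
  by elim: (j) => //= j' ->; rewrite rmorphM fD.
rewrite iterSr fd iterD iterDM (IHj m.+1) ?(ltnW jm) // (IHj m) //.
rewrite !big_ord_recl !bin0 -addrA; congr (_ + _).
rewrite mulr_sumr -big_split; apply: eq_bigr => l _ /=.
by rewrite /bump add1n binS mulrnDr mulrnAr exprS addnS addSn mulrA.
Qed.

Variable p : nat.
Hypothesis hp : p \in [pchar T].

Let mulrn_p (x : T) m : (p %| m)%N -> x *+ m = 0.
Proof. by rewrite (dvdn_pcharf hp) => /eqP m0; rewrite -mulr_natr m0 mulr0. Qed.

Lemma sum_bin m i : (\sum_(j < m) 'C(j, i))%N = 'C(m, i.+1).
Proof.
elim: m => [|m IHm]; first by rewrite big_ord0 bin0n.
by rewrite big_ord_recr IHm binS.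
Qed.

Let bin_p (d' : T) (l : nat) : (l.+1 < p)%N -> d' *+ 'C(p, l.+1) = 0.
Proof. by move=> lp; apply/mulrn_p/prime_dvd_bin; rewrite // (pcharf_prime hp). Qed.

(** This is [1 + f + ... + f^(p-1) = (f - 1)^(p-1)]: summing ['C(j, l)] over [j < p] gives
    ['C(p, l.+1)], which is divisible by [p] unless [l = p - 1]. *)
Lemma sum_iter_difference : \sum_(j < p) iter j f (d 0%N) = D ^+ p.-1 * d p.-1.
Proof.
under eq_bigr => j _ do rewrite (iter_difference 0 (ltn_ord j)).
rewrite exchange_big /=; under eq_bigr => l _ do rewrite sumrMnr sum_bin.
have := bin_p; case: p (prime_gt0 (pcharf_prime hp)) => // q _ binq.
rewrite big_ord_recr /= binn add0n mulr1n big1 ?add0r // => l _.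
by rewrite binq // ltnS.
Qed.

(** This is [f^p - 1 = (f - 1)^p] in characteristic [p]. *)
Lemma iter_p_difference : iter p f (d 0%N) = d 0%N + D ^+ p * d p.
Proof.
rewrite (iter_difference 0 (ltnSn p)).
have := bin_p; case: p (prime_gt0 (pcharf_prime hp)) => // q _ binq.
rewrite big_ord_recl big_ord_recr /= /bump !add1n !add0n binn bin0 mulr1n expr0 mul1r.
by rewrite big1 ?add0r // => l _; rewrite add1n binq // ltnS.
Qed.

End IteratedDifference.

(** Viewed as polynomials in [x], the two products containing [x] are monic of degree [size V], so
    [Q], the difference of the two sides, has smaller degree. Translation by [w] in [V] permutes
    [V], so [Q] vanishes on all of [V], hence is zero. *)
Lemma additive_product (T : idomainType) (V : seq T) (x t : T) : uniq V -> 0 \in V ->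
  {in V &, forall a b, a + b \in V} ->
  \prod_(v <- V) (x + t + v) = \prod_(v <- V) (x + v) + \prod_(v <- V) (t + v).
Proof.
move=> uV V0 VD.
pose P u : {poly T} := \prod_(v <- V) ('X - (- (u + v))%:P).
have PE u y : (P u).[y] = \prod_(v <- V) (y + u + v).
  by rewrite horner_prod; apply: eq_bigr => v _; rewrite hornerXsubC opprK addrA.
have P_monic u : P u \is monic /\ size (P u) = (size V).+1.
  rewrite /P -(big_map (fun v => - (u + v)) predT (fun a => 'X - a%:P)).
  by rewrite monic_prod_XsubC size_prod_XsubC size_map.
pose Q := P t - P 0 - (\prod_(v <- V) (t + v))%:P.
have shiftV w u : w \in V -> \prod_(v <- V) (w + u + v) = \prod_(v <- V) (u + v).
  move=> wV; have uwV : uniq [seq w + v | v <- V] by rewrite (map_inj_uniq (@addrI _ w)).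
  have sub : {subset [seq w + v | v <- V] <= V} by move=> _ /mapP[v vV ->]; apply: VD.
  have [_ /(uniq_perm uwV uV) eqV] := uniq_min_size uwV sub (eq_leq (esym (size_map _ _))).
  by rewrite -[RHS](perm_big _ eqV) big_map; apply: eq_bigr => v _; rewrite [w + u]addrC addrA.
have Q0 : Q = 0.
  apply/eqP; apply: contraT => nQ.
  have rootV : all (root Q) V.
    apply/allP => w wV; rewrite rootE !hornerE !PE shiftV // addr0.
    rewrite [X in _ - X - _](_ : _ = 0) ?subr0 ?subrr //.
    by rewrite -[w]addr0 shiftV // (big_rem 0) //= addr0 mul0r.
  have := max_poly_roots nQ rootV uV; rewrite ltnNge; case/negP.
  apply/leq_sizeP => j; rewrite leq_eqVlt !coefB coefC.
  have sV : (0 < size V)%N by case: (V) V0.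
  have [mt st] := P_monic t; have [m0 s0] := P_monic 0.
  case/orP => [/eqP <-|lt].
    move: mt m0; rewrite !monicE !lead_coefE st s0 /= => /eqP -> /eqP ->.
    by rewrite subrr gtn_eqF // subr0.
  by rewrite !nth_default ?st ?s0 // gtn_eqF ?(ltn_trans sV) // !subr0.
have : Q.[x] = 0 by rewrite Q0 horner0.
rewrite !hornerE !PE addr0 => /eqP; rewrite -addrA -opprD subr_eq0 => /eqP ->.
by [].
Qed.

(** * Transvections outside the normal subgroup *)

(* Locked, because unification otherwise unfolds [fix_last] into polynomial computations. *)
HB.lock Definition moves_last (k : fieldType) (n : nat) (M : 'M[k]_n.+1) : bool :=
  fix_last M.

Section LastTransvection.

Variables (p : nat) (k : fieldType) (n : nat) (gT : finGroupType).
Variables (G : {group gT}) (rG : mx_representation k G n.+1) (N : {group gT}) (s : gT).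

Hypotheses (hp : p \in [pchar k]) (rG_faithful : mx_faithful rG).
Hypotheses (rG_tri : unitriangular rG) (nNG : (N <| G)%g).
Hypothesis genN : <<transvections rG N>>%g = N.
Hypotheses (s_tv : s \in transvections rG G) (sN : s \notin N).
Hypothesis quoN : (G / N)%g = <[coset N s]>%g.
Hypothesis beta_s : (beta_grp rG N < beta (rG s))%N.
Hypothesis fix_s : forall i : 'I_n.+1, i != ord_max -> gl_act (rG s) 'X_i = 'X_i.

Let sG : s \in G. Proof. by have:= s_tv; rewrite inE => /andP[]. Qed.
Let NG g : g \in N -> g \in G. Proof. by move: g; apply/subsetP/normal_sub. Qed.
Let p_pr : prime p. Proof. exact: pcharf_prime hp. Qed.

Implicit Types (g h t : gT) (i j l : 'I_n.+1) (v : 'cV[k]_n.+1).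

Local Notation b := (beta_grp rG N).
Local Notation xn := (@ord_max n).
Local Notation move g := (rG g - 1).
Local Notation fixl g := (moves_last (rG g)).

(** The coordinates of the form [d g = g x_n - x_n]. *)
Definition shift (g : gT) : 'cV[k]_n.+1 := col xn (move g).

Lemma moveM g h : g \in G -> h \in G -> move (g * h)%g = move g *m rG h + move h.
Proof. by move=> gG hG; rewrite repr_mxM // mulmxBl mul1mx addrA subrK. Qed.

Lemma move_unitri g i j : g \in G -> (i <= j)%N -> move g j i = 0.
Proof.
move=> gG ij; rewrite -mcoeff_gl_actX; have [c ->] := rG_tri i gG.
rewrite raddf_sum big1 // => l li /=; rewrite mcoeffZ mcoeffXU.
by rewrite -val_eqE ltn_eqF ?mulr0 // (leq_trans li).
Qed.

(** The vanishing of the rows from [b] on is stable under products and holds for the generating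
    transvections. Indices are zero-based while [b] is one-based, so [j = b] is already excluded
    from the support. *)
Lemma move_N g i j : g \in N -> (b <= j)%N -> move g j i = 0.
Proof.
have grp : group_set [set g in G | [forall j : 'I_n.+1, (b <= j)%N ==> (row j (move g) == 0)]].
  apply/group_setP; split=> [|g' h].
    rewrite inE group1; apply/forallP => j'; apply/implyP => _.
    by rewrite repr_mx1 subrr row0.
  rewrite !inE => /andP[gG /forallP g0] /andP[hG /forallP h0]; rewrite groupM //.
  apply/forallP => j'; apply/implyP => bj.
  have := g0 j'; have := h0 j'; rewrite bj /= => /eqP h0' /eqP g0'.
  by rewrite moveM // raddfD /= row_mul g0' h0' mul0mx addr0.
suff : <<transvections rG N>>%g \subset Group grp.
  rewrite genN => /subsetP sub /sub; rewrite inE.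
  move=> /andP[_ /forallP/(_ j)/implyP g0 /g0 /eqP/rowP/(_ i)].
  by rewrite !mxE.
rewrite gen_subG; apply/subsetP => g'; rewrite !inE => /andP[gN tv].
rewrite NG //; apply/forallP => j'; apply/implyP => bj; apply/eqP/rowP => i'.
rewrite [RHS]mxE mxE; apply/eqP; apply: contraTT bj => /leq_beta lt.
rewrite -ltnNge (leq_trans lt) //; apply: leq_bigmax_cond.
by rewrite inE gN.
Qed.

(** The flag [moves_last] says that at most the last variable is moved, so only the last column of
    [move g] can be nonzero. *)
Lemma fixlP g : reflect (move g = shift g *m delta_mx 0 xn) (fixl g).
Proof.
rewrite moves_last.unlock; apply: (iffP forallP) => [fixg|eg i].
  apply/matrixP => j i; rewrite [RHS]mxE big_ord1 [delta_mx _ _ _ _]mxE eqxx /=.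
  have [->|ne] := eqVneq i xn; first by rewrite mulr1 [RHS]mxE.
  have := fixg i; rewrite ne /= => /eqP fi.
  by rewrite mulr0 -mcoeff_gl_actX fi subrr mcoeff0.
apply/implyP => ne; rewrite -subr_eq0 gl_actX lin_delta -linearB lin_eq0.
apply/eqP/colP => j; move/matrixP/(_ j i): eg.
rewrite !mxE big_ord1 !mxE (negPf ne) andbF mulr0 => e.
by rewrite -[RHS]e andbT.
Qed.

Lemma fixl_s : fixl s.
Proof. by rewrite moves_last.unlock; apply/forallP => i; apply/implyP => ne; rewrite fix_s. Qed.

Lemma shift_last g : g \in G -> shift g xn 0 = 0.
Proof. by move=> gG; rewrite mxE move_unitri. Qed.

Lemma move_shift_fix g h : fixl g -> h \in G -> move g *m shift h = 0.
Proof.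
move=> /fixlP -> hG; rewrite -mulmxA -rowE.
by rewrite [row xn _]mx11_scalar mxE shift_last // mul_mx_scalar scale0r.
Qed.

(** The cross term [move g *m move h] vanishes because [shift h] has no [x_n]-coordinate. Thus
    [shift] is additive on elements moving only [x_n]; being injective there, it makes them an
    elementary abelian [p]-group. *)
Lemma fixlM g h : g \in G -> h \in G -> fixl g -> fixl h ->
  fixl (g * h)%g /\ shift (g * h)%g = shift g + shift h.
Proof.
move=> gG hG fg fh.
have e : move (g * h)%g = move g + move h.
  rewrite moveM //; congr (_ + _).
  have -> : move g *m rG h = move g *m move h + move g by rewrite mulmxBr mulmx1 subrK.
  rewrite (fixlP _ fh).
  by rewrite mulmxA move_shift_fix // mul0mx add0r.
have e' : shift (g * h)%g = shift g + shift h by rewrite /shift e raddfD.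
split; [apply/fixlP | exact: e'].
by rewrite e e' mulmxDl -(fixlP _ fg) -(fixlP _ fh).
Qed.

Lemma fixl1 : fixl 1%g /\ shift 1%g = 0.
Proof.
have e : shift 1%g = 0 by rewrite /shift repr_mx1 subrr col0.
by split=> //; apply/fixlP; rewrite e mul0mx repr_mx1 subrr.
Qed.

Lemma fixlX g (m : nat) : g \in G -> fixl g ->
  fixl (g ^+ m)%g /\ shift (g ^+ m)%g = shift g *+ m.
Proof.
move=> gG fg; elim: m => [|m [IH1 IH2]]; first by rewrite expg0 mulr0n; apply: fixl1.
rewrite expgS mulrS -IH2; apply: fixlM => //; exact: groupX.
Qed.

Lemma fixl_shift_inj g h : g \in G -> h \in G -> fixl g -> fixl h ->
  shift g = shift h -> g = h.
Proof.
move=> gG hG fg fh e; apply: (mx_faithful_inj rG_faithful) => //.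
by apply: (addIr (- 1)); rewrite (fixlP _ fg) (fixlP _ fh) e.
Qed.

Lemma fixl_expgp g : g \in G -> fixl g -> (g ^+ p = 1)%g.
Proof.
move=> gG fg; have [f1 e1] := fixl1; have [fp ep] := fixlX p gG fg.
apply: fixl_shift_inj; rewrite ?groupX //.
by rewrite e1 ep -scaler_nat (pcharf0 hp) scale0r.
Qed.

Lemma fixlV g : g \in G -> fixl g -> fixl g^-1%g.
Proof.
move=> gG fg; have -> : (g^-1 = g ^+ p.-1)%g; last by have [] := fixlX p.-1 gG fg.
by apply: (mulgI g); rewrite mulgV -expgS prednK ?prime_gt0 // fixl_expgp.
Qed.

(** [beta (rG s)] is positive, hence attained, and in the last column, the only one where [s] acts.
    It is one-based and exceeds [b], whence [b <= j]. *)
Lemma leading_index : exists j : 'I_n.+1, [/\ shift s j 0 != 0, (b <= j)%N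
   & forall j' : 'I_n.+1, (j < j')%N -> shift s j' 0 = 0].
Proof.
have [j ej [i sji]] := beta_attained (leq_ltn_trans (leq0n _) beta_s).
have ei : i = xn.
  apply/eqP; apply: contraNT sji => ne; rewrite (fixlP _ fixl_s).
  by rewrite mxE big_ord1 [delta_mx _ _ _ _]mxE (negPf ne) mulr0.
have sj : shift s j 0 != 0 by rewrite mxE -ei.
exists j; split=> //; first by have := beta_s; rewrite -ej ltnS.
move=> j' jj'; apply/eqP; apply: contraTT jj'; rewrite mxE => /leq_beta.
by rewrite -ej ltnS -leqNgt.
Qed.

Lemma cosetG g : g \in G -> exists m : 'I_p, ((s ^+ m)^-1 * g)%g \in N.
Proof.
have /subsetP nNGs : G \subset 'N(N)%g by exact: normal_norm.
move=> gG; have : coset N g \in (G / N)%g by rewrite mem_quotient.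
rewrite quoN => /cycleP[m em].
exists (Ordinal (ltn_pmod m (prime_gt0 p_pr))) => /=.
rewrite expg_mod ?fixl_expgp ?fixl_s //.
have sm : (s ^+ m)%g \in 'N(N)%g by rewrite groupX ?nNGs.
apply: coset_idr; first by rewrite groupM ?groupV // nNGs.
by rewrite morphM ?groupV ?(nNGs g) // morphV // morphX ?nNGs //= em mulVg.
Qed.

(** * Elements outside [N], read off from the leading coordinate [r] *)

Section LeadingIndex.

Variable r : 'I_n.+1.
Hypotheses (s_r : shift s r 0 != 0) (br : (b <= r)%N).
Hypothesis s_above : forall j, (r < j)%N -> shift s j 0 = 0.

Let bn : (b <= xn)%N. Proof. by rewrite (leq_trans br) // -ltnS ltn_ord. Qed.

(** Write [g = s^m h] with [h] in [N]. The cross term vanishes because no [h x_i - x_i] contains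
    [x_n]: row [xn] lies in the range where [move_N] applies. *)
Lemma move_coset (m : nat) g : g \in G -> ((s ^+ m)^-1 * g)%g \in N ->
  move g = move ((s ^+ m)^-1 * g)%g + (shift s *+ m) *m delta_mx 0 xn.
Proof.
move=> gG; set h := (_ * _)%g => hN.
have [fm em] := fixlX m sG fixl_s.
have hG := NG hN; have smG : (s ^+ m)%g \in G := groupX m sG.
have eg : g = (s ^+ m * h)%g by rewrite mulKVg.
rewrite [in LHS]eg (moveM smG hG) addrC; congr (_ + _).
have -> : move (s ^+ m)%g *m rG h = move (s ^+ m)%g *m move h + move (s ^+ m)%g.
  by rewrite mulmxBr mulmx1 subrK.
rewrite (fixlP _ fm) em -mulmxA -rowE.
have -> : row xn (move h) = 0 by apply/rowP => i; rewrite [RHS]mxE mxE move_N.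
by rewrite mulmx0 add0r.
Qed.

Lemma natr_mul_eq0 (m : nat) v : (v r 0 *+ m == 0) = (p %| m)%N || (v r 0 == 0).
Proof. by rewrite -mulr_natr mulf_eq0 orbC -(dvdn_pcharf hp). Qed.

Lemma shift_coset (m : nat) g : g \in G -> ((s ^+ m)^-1 * g)%g \in N ->
  shift g r 0 = shift s r 0 *+ m.
Proof.
move=> gG gN; rewrite /shift mxE (move_coset gG gN) mxE move_N // add0r.
by rewrite mxE big_ord1 [delta_mx _ _ _ _]mxE !eqxx mulr1 mulmxnE.
Qed.

(** Row [r] of [move g] ignores the factor in [N], so the coordinate is [m] times that of [s], with
    [m < p] the exponent of the coset. *)
Lemma shift_r_eq0 g : g \in G -> (shift g r 0 == 0) = (g \in N).
Proof.
move=> gG; apply/idP/idP => [|gN]; last by rewrite mxE move_N.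
have [m gN] := cosetG gG; rewrite (shift_coset gG gN) natr_mul_eq0 (negPf s_r) orbF.
have [m0 _|m0] := posnP m; last by rewrite gtnNdvd.
by move: gN; rewrite m0 expg0 invg1 mul1g.
Qed.

Lemma move_above g i j : g \in G -> i != xn -> (b <= j)%N -> move g j i = 0.
Proof.
move=> gG ne bj; have [m gN] := cosetG gG.
rewrite (move_coset gG gN) mxE move_N // add0r mxE big_ord1 [delta_mx _ _ _ _]mxE.
by rewrite (negPf ne) mulr0.
Qed.

Lemma shift_above g j : g \in G -> (r < j)%N -> shift g j 0 = 0.
Proof.
move=> gG rj; have [m gN] := cosetG gG; rewrite mxE (move_coset gG gN) mxE.
rewrite move_N //; last exact: leq_trans br (ltnW rj).
by rewrite add0r mxE big_ord1 mulmxnE s_above // mul0rn mul0r.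
Qed.

(** Write [move t = a *m phi]. Outside [N] the entry [a_r] is nonzero, while row [r] of [move t]
    vanishes off the last column; hence [phi] is supported on the last column. *)
Lemma transvection_fixl t : t \in transvections rG G -> t \notin N -> fixl t.
Proof.
rewrite inE => /andP[tG tv] tN; have [a [phi e]] := transvection_factor tv.
have : shift t r 0 != 0 by rewrite shift_r_eq0.
rewrite mxE e mxE big_ord1 mulf_eq0 negb_or => /andP[ar _].
apply/fixlP/matrixP => j i; rewrite [RHS]mxE big_ord1 [delta_mx _ _ _ _]mxE /=.
have [->|ne] := eqVneq i xn; first by rewrite mulr1 [RHS]mxE.
have /eqP := move_above tG ne br; rewrite e mxE big_ord1 mulf_eq0 (negPf ar) /= => /eqP p0.
by rewrite mxE big_ord1 p0 !mulr0.
Qed.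

Lemma fixl_transvection t : t \in G -> fixl t -> t != 1%g -> transvection (rG t).
Proof.
move=> tG ft t1; apply: (rank1_transvection (fixlP _ ft)).
- apply: contra t1 => /eqP e; have [f1 e1] := fixl1.
  by apply/eqP/fixl_shift_inj; rewrite // e e1.
- by apply/rV0Pn; exists xn; rewrite mxE !eqxx oner_eq0.
rewrite -rowE; apply/rowP => i; rewrite [RHS]mxE mxE ord1 shift_last //.
Qed.

(** The elements of [N] moving only [x_n] form a group, and each nontrivial one is a transvection,
    so the generated group adds nothing. *)
Lemma Hgrp_fixl : Hgrp rG N = [set g in N | fixl g].
Proof.
have -> : Hgrp rG N = <<[set g in transvections rG N | fixl g]>>%g.
  by rewrite moves_last.unlock.
have grp : group_set [set g in N | fixl g].
  apply/group_setP; split=> [|g h]; first by rewrite inE group1; case: fixl1.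
  rewrite !inE => /andP[gN fg] /andP[hN fh]; rewrite groupM //.
  by have [] := fixlM (NG gN) (NG hN) fg fh.
apply/eqP; rewrite eqEsubset; apply/andP; split.
  suff : <<[set g in transvections rG N | fixl g]>>%g \subset Group grp by [].
  rewrite gen_subG; apply/subsetP => g.
  by rewrite !inE => /andP[/andP[-> _] ->].
apply/subsetP => g; rewrite inE => /andP[gN fg].
have [->|g1] := eqVneq g 1%g; first exact: group1.
by apply: mem_gen; rewrite !inE gN fg fixl_transvection ?NG.
Qed.

Lemma outer_transvectionsE : transvections rG G :\: N = [set t in G :\: N | fixl t].
Proof.
apply/setP => t; rewrite !inE; apply/andP/andP => [[tN /andP[tG tv]]|[/andP[tN tG] ft]].
  by rewrite tN tG; split=> //; apply: transvection_fixl => //; rewrite inE tG.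
rewrite tN tG fixl_transvection //.
by apply: contraNneq tN => ->; apply: group1.
Qed.

(* The coset [sigma H]; cut out by the coordinate [r] because that is visibly stable
   under conjugation by [G]. *)
Definition sH : {set gT} := [set t in G | fixl t & shift t r 0 == shift s r 0].
Definition disc : {mpoly k[n.+1]} := \prod_(t in sH) lin (shift t).

Lemma sH_coset t : t \in sH -> (s^-1 * t)%g \in N.
Proof.
rewrite inE => /and3P[tG ft /eqP e]; have [fV fs] := (fixlV sG fixl_s, fixl_s).
rewrite -shift_r_eq0 ?groupM ?groupV //.
have [] := fixlM sG (groupM (groupVr sG) tG) fs; last first.
  move=> _; rewrite mulKVg => /colP/(_ r); rewrite [RHS]mxE e => /eqP.
  by rewrite addrC -subr_eq subrr eq_sym.
by have [] := fixlM (groupVr sG) tG fV ft.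
Qed.

Lemma sH_notin t : t \in sH -> t \notin N.
Proof. by rewrite inE => /and3P[tG _ /eqP e]; rewrite -shift_r_eq0 // e. Qed.

Lemma discE : disc = \prod_(h in [set g in N | fixl g]) lin (shift s + shift h).
Proof.
rewrite /disc (reindex_inj (mulgI s)) /=; apply: eq_big => [h|h]; last first.
  move=> /[dup] /sH_coset; rewrite mulKg => hN; rewrite inE => /and3P[shG fsh _].
  have fh : fixl h.
    rewrite -[h](mulKg s); apply: (proj1 (fixlM _ _ _ _)) => //.
      by rewrite groupV.
    exact: fixlV fixl_s.
  by rewrite (proj2 (fixlM sG (NG hN) fixl_s fh)).
apply/idP/idP => [/[dup] /sH_coset|].
  rewrite mulKg !inE => hN /and3P[shG fsh _]; rewrite hN /= -[h](mulKg s).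
  by apply: (proj1 (fixlM _ _ _ _)); rewrite ?groupV //; apply: fixlV fixl_s.
rewrite !inE => /andP[hN fh]; have [f e] := fixlM sG (NG hN) fixl_s fh.
have hr : shift h r 0 = 0 by apply/eqP; rewrite shift_r_eq0 // NG.
by rewrite f e (groupM sG (NG hN)) [X in X == _]mxE hr addr0 eqxx.
Qed.

Lemma fixl_shiftP g v : move g = v *m delta_mx 0 xn -> fixl g /\ shift g = v.
Proof.
move=> e; have ev : shift g = v.
  rewrite /shift e colE -mulmxA mul_delta_mx.
  by apply/colP => j; rewrite mxE big_ord1 mxE mulr1.
by split=> //; apply/fixlP; rewrite ev.
Qed.

Lemma mul_rG_r g v : g \in G -> v xn 0 = 0 -> (rG g *m v) r 0 = v r 0.
Proof.
move=> gG v0; have -> : rG g *m v = move g *m v + v by rewrite mulmxBl mul1mx subrK.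
rewrite mxE [X in X + _]mxE big1 ?add0r // => i _.
by have [->|ne] := eqVneq i xn; rewrite ?v0 ?mulr0 // move_above ?mul0r.
Qed.

(** Conjugation turns [v *m e] into [(rG g *m v) *m (e *m rG g^-1)], and [e] is unchanged since
    unitriangularity makes row [xn] of [move g^-1] zero. *)
Lemma fixl_conj g t : g \in G -> t \in G -> fixl t ->
  fixl (t ^ g^-1)%g /\ shift (t ^ g^-1)%g = rG g *m shift t.
Proof.
move=> gG tG ft; apply: fixl_shiftP; rewrite conjgE invgK.
pose e : 'rV[k]_n.+1 := delta_mx 0 xn.
have row_gV : e *m rG g^-1%g = e.
  have -> : e *m rG g^-1%g = row xn (move g^-1%g) + e.
    by rewrite rowE mulmxBr mulmx1 subrK.
  have -> : row xn (move g^-1%g) = 0; last by rewrite add0r.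
  by apply/rowP => i; rewrite [RHS]mxE mxE move_unitri ?groupV // -ltnS ltn_ord.
rewrite !repr_mxM ?groupM ?groupV //.
have -> : 1 = rG g *m rG g^-1%g by rewrite -repr_mxM ?groupV // mulgV repr_mx1.
rewrite [rG t *m _](_ : _ = (move t + 1) *m rG g^-1%g); last by rewrite subrK.
by rewrite mulmxDl mul1mx mulmxDr addrK (fixlP _ ft) -mulmxA row_gV mulmxA.
Qed.

Lemma sH_conj g t : g \in G -> t \in sH -> (t ^ g^-1)%g \in sH.
Proof.
move=> gG; rewrite inE => /and3P[tG ft tr]; have [f e] := fixl_conj gG tG ft.
by rewrite inE groupJ ?groupV // f e mul_rG_r ?shift_last.
Qed.

Lemma disc_invariant g : g \in G -> gl_act (rG g) disc = disc.
Proof.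
move=> gG; rewrite rmorph_prod [RHS](reindex_inj (conjg_inj g^-1%g)) /=.
apply: eq_big => [t|t]; last first.
  by rewrite inE => /and3P[tG ft _]; rewrite gl_act_lin (proj2 (fixl_conj gG tG ft)).
apply/idP/idP => [|/(sH_conj (groupVr gG))]; first exact: sH_conj.
by rewrite -conjgM mulgV conjg1.
Qed.

(** Both forms have the same nonzero coefficient at [x_r], so divisibility forces them to be
    equal. *)
Lemma shift_sH_divides t t' : t \in sH -> t' \in sH -> t != t' ->
  ~ divides (lin (shift t)) (lin (shift t')).
Proof.
rewrite !inE => /and3P[tG ft /eqP tr] /and3P[t'G ft' /eqP tr'] ne.
rewrite (@dividesP _ _ _ r) ?tr // gl_act_lin kill_mxE tr tr' divff // scale1r.
move/eqP; rewrite lin_eq0 subr_eq0 => /eqP e; case/eqP: ne.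
exact: fixl_shift_inj.
Qed.

Lemma shift_neq0 g : g \in G -> g \notin N -> shift g != 0.
Proof. by move=> gG gN; apply/cV0Pn; exists r; rewrite shift_r_eq0. Qed.

Lemma disc_neq0 : disc != 0.
Proof.
apply/prodf_neq0 => t tH; rewrite lin_eq0 shift_neq0 ?sH_notin //.
by have:= tH; rewrite inE => /and3P[].
Qed.

(** * The trace of invariants is divisible by [disc ^+ p.-1] *)

Local Notation S := {mpoly k[n.+1]}.
Local Notation A := (is_invariant rG N).
Local Notation R := (is_invariant rG G).

Lemma rG_actM g h f : g \in G -> h \in G ->
  gl_act (rG (g * h)%g) f = gl_act (rG g) (gl_act (rG h) f).
Proof. by move=> gG hG; rewrite (repr_mxM rG gG hG) gl_act_mulmx. Qed.

Lemma disc_divides_diff f : A f -> divides disc (gl_act (rG s) f - f).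
Proof.
move=> Af; rewrite /disc -big_enum /=.
apply: prod_lin_divides => [|t|t t'|t]; rewrite ?enum_uniq ?mem_enum //.
- move=> /[dup] /sH_notin tN; rewrite inE => /and3P[tG _ _]; exact: shift_neq0.
- exact: shift_sH_divides.
move=> tH; have := tH; rewrite inE => /and3P[tG ft _].
(* [t] lies in the coset [s N], so it acts on [f] as [s] does; it moves variables only by multiples
   of [lin (shift t)]. *)
have -> : gl_act (rG s) f = gl_act (rG t) f.
  by rewrite -[t](mulKVg s) (rG_actM _ sG (NG (sH_coset tH))) (Af _ (sH_coset tH)).
apply: gl_act_divides => i; rewrite lin_delta gl_act_lin -linearB -[X in _ - X]mul1mx -mulmxBl.
rewrite (fixlP _ ft) -mulmxA -rowE; have [->|/negPf ne] := eqVneq i xn.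
  have -> : row xn (delta_mx xn 0 : 'cV[k]_n.+1) = 1%:M.
    by apply/rowP => j; rewrite !mxE !ord1 !eqxx.
  by rewrite mulmx1; exists 1; rewrite mul1r.
have -> : row xn (delta_mx i 0 : 'cV[k]_n.+1) = 0.
  by apply/rowP => j; rewrite !mxE eq_sym ne.
by rewrite mulmx0 linear0; exists 0; rewrite mul0r.
Qed.

Let act g : {rmorphism S -> S} := gl_act (rG g).

Let act1 : act 1%g =1 id.
Proof. by move=> f; rewrite /act /= repr_mx1 gl_act1. Qed.

Let actM g h : g \in G -> h \in G -> forall f, act (g * h)%g f = act g (act h f).
Proof. by move=> gG hG f; apply: rG_actM. Qed.

Let s_expgp : (s ^+ p = 1)%g. Proof. exact: fixl_expgp fixl_s. Qed.

Let spN : (s ^+ p)%g \in N. Proof. by rewrite s_expgp group1. Qed.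

Let act_sX (m : nat) f : act (s ^+ m)%g f = iter m (act s) f.
Proof. exact: (act_expg act1 actM m f sG). Qed.

Let actG_inj g : g \in G -> injective (act g).
Proof. by move=> gG; apply: (act_injective act1 actM gG). Qed.

(** By normality [s f] is again [N]-invariant, and so is [disc]; hence so is the quotient. *)
Lemma diff_quotient f : A f -> exists2 f', A f' & gl_act (rG s) f = f + disc * f'.
Proof.
move=> Af; have [f' e] := disc_divides_diff Af.
exists f'; last by rewrite mulrC -e addrC subrK.
move=> h hN; have hG := NG hN; have hsN : (h ^ s)%g \in N.
  by rewrite memJ_norm // (subsetP (normal_norm nNG)).
have sf : gl_act (rG h) (gl_act (rG s) f) = gl_act (rG s) f.
  by rewrite -(rG_actM f hG sG) conjgC (rG_actM f sG (NG hsN)) (Af _ hsN).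
apply: (mulIf disc_neq0); rewrite -{1}(disc_invariant hG) -rmorphM.
by rewrite -e rmorphB /= sf (Af _ hN).
Qed.

(** Iterated difference quotients give [d] with [s d_m = d_m + disc * d_(m+1)], and the trace is
    [disc^(p-1) d_(p-1)]. From [s^p = 1] follows [disc^p d_p = 0], so [s] fixes [d_(p-1)], which is
    therefore [G]-invariant. *)
Lemma trace_disc f : A f -> exists2 f', R f' &
  \sum_(j < p) gl_act (rG (s ^+ j)%g) f = disc ^+ p.-1 * f'.
Proof.
move=> Af.
pose next (x : S) := epsilon (inhabits 0) (fun y => A y /\ gl_act (rG s) x = x + disc * y).
have nextP x : A x -> A (next x) /\ gl_act (rG s) x = x + disc * next x.
  move=> Ax; apply: (epsilon_spec (inhabits 0) (fun y => A y /\ gl_act (rG s) x = x + disc * y)).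
  by have [y] := diff_quotient Ax; exists y.
pose d (m : nat) := iter m next f.
have Ad (m : nat) : A (d m) by elim: m => //= m IHm; have [] := nextP _ IHm.
have sd (m : nat) : act s (d m) = d m + disc * d m.+1 by have [] := nextP _ (Ad m).
have hpS : p \in [pchar S] by rewrite pchar_lalg.
have sdisc : act s disc = disc := disc_invariant sG.
exists (d p.-1); last first.
  rewrite -(sum_iter_difference sdisc sd hpS).
  by apply: eq_bigr => j _; rewrite -act_sX.
have dp : d p = 0.
  have := iter_p_difference sdisc sd hpS; rewrite -act_sX s_expgp act1.
  move/eqP; rewrite -subr_eq0 opprD addNKr oppr_eq0 mulf_eq0 expf_eq0 (negPf disc_neq0) andbF /=.
  by move/eqP.
have sfix : act s (d p.-1) = d p.-1.
  by rewrite sd prednK ?prime_gt0 // dp mulr0 addr0.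
move=> g gG; have [m gN] := cosetG gG.
rewrite -[g](mulKVg (s ^+ m)%g) (rG_actM _ (groupX m sG) (NG gN)) (Ad _ _ gN).
rewrite -[LHS]/(act (s ^+ m)%g _) act_sX.
by elim: (nat_of_ord m) => //= m' ->.
Qed.

Lemma linN v : lin (- v) = - lin v.
Proof. exact: linearN. Qed.

Lemma gl_act_last g : gl_act (rG g) 'X_xn - 'X_xn = lin (shift g).
Proof.
by rewrite lin_delta gl_act_lin -linearB -[X in _ - X]mul1mx -mulmxBl /shift colE.
Qed.

Lemma move_last g : g \in G -> g \notin N -> act g 'X_xn != 'X_xn.
Proof.
by move=> gG gN; rewrite -subr_eq0 /act /= gl_act_last lin_eq0 shift_neq0.
Qed.

Let F := frac_field A.

Lemma outer_trace y : F y ->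
  field_trace (frac_field R) F y = \sum_(j < p) frac_map (gl_act (rG (s ^+ j)%g)) y.
Proof.
have [a Aa sa] := exists_moved_invariant act1 actM nNG sG sN move_last.
exact: (field_traceE act1 actM p_pr nNG sG spN cosetG Aa sa).
Qed.

Lemma codifferent_mul_prod_act y f : codifferent A R y ->
  exists z, y * tofrac (\prod_(g in G :\: N) (f - gl_act (rG g) f)) = tofrac z.
Proof.
have [a Aa sa] := exists_moved_invariant act1 actM nNG sG sN move_last.
exact: (codifferent_mul_prod act1 actM p_pr nNG sG sN spN cosetG f Aa sa).
Qed.

Lemma frac_fieldN_fix y h : F y -> h \in N -> frac_map (gl_act (rG h)) y = y.
Proof.
by move=> Fy hN; apply: (frac_field_fact act1 actM (normal_sub nNG) Fy hN).
Qed.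

Let discP := disc ^+ p.-1.

Lemma discP_invariant g : g \in G -> gl_act (rG g) discP = discP.
Proof. by move=> gG; rewrite rmorphXn /= disc_invariant. Qed.

Lemma inv_disc_codifferent : codifferent A R (tofrac discP)^-1.
Proof.
have d0 : discP != 0 by rewrite expf_neq0 ?disc_neq0.
split=> [|f Af].
  exists 1, discP; split=> //; last by rewrite tofrac1 div1r.
    by move=> g _; rewrite rmorph1.
  by move=> g gN; apply/discP_invariant/NG.
have Ff : F ((tofrac discP)^-1 * tofrac f).
  exists f, discP; split=> //; last by rewrite mulrC.
  by move=> g gN; apply/discP_invariant/NG.
rewrite (outer_trace Ff); have [f' Rf' e] := trace_disc Af.
exists f' => //; apply: (mulfI (x := tofrac discP)); first by rewrite tofrac_eq0.
rewrite -tofracM -e rmorph_sum mulr_sumr; apply: eq_bigr => j _ /=.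
have sjG := groupX j sG; have sji := actG_inj sjG.
rewrite [_^-1 * _]mulrC (frac_map_div sji) //= (discP_invariant sjG).
by rewrite mulrC divfK ?tofrac_eq0.
Qed.

(** * Bounding the denominators of the codifferent *)

Lemma gl_act_var g i : gl_act (rG g) 'X_i - 'X_i = lin (col i (move g)).
Proof. by rewrite lin_delta gl_act_lin -linearB -[X in _ - X]mul1mx -mulmxBl colE. Qed.

Lemma fixl_col g i : fixl g -> i != xn -> col i (move g) = 0.
Proof.
move=> /fixlP -> /negPf ne; apply/colP => j.
by rewrite mxE mxE big_ord1 [delta_mx _ _ _ _]mxE ne andbF mulr0 [RHS]mxE.
Qed.

Lemma not_fixl_col g : ~~ fixl g -> exists2 i, i != xn & col i (move g) != 0.
Proof.
move=> nf; suff /exists_inP[i ne ni] : [exists (i | i != xn), col i (move g) != 0] by exists i.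
apply: contraNT nf => /exists_inPn c0; apply/fixlP/matrixP => j i.
rewrite [RHS]mxE big_ord1 [delta_mx _ _ _ _]mxE eqxx /=.
have [->|ne] := eqVneq i xn; first by rewrite mulr1 [RHS]mxE.
by have := c0 _ ne; rewrite negbK => /eqP/colP/(_ j); rewrite mulr0 [LHS]mxE [X in _ = X]mxE.
Qed.

(** The invariant [x_1] serves as a weight: under [probe - g probe], the variable [x_n] contributes
    in degree 1 and each other ['X_j] in degree [2 j + 3]. *)
Definition probe : S := 'X_xn + \sum_(j < n.+1 | j != xn) 'X_j * 'X_ord0 ^+ (j.+1).*2.

Lemma gl_act_first g : g \in G -> gl_act (rG g) 'X_ord0 = 'X_ord0.
Proof.
move=> gG; apply/eqP; rewrite -subr_eq0 gl_act_var lin_eq0; apply/eqP/colP => j.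
by rewrite mxE [RHS]mxE move_unitri.
Qed.

Lemma probe_diff g : g \in G -> probe - gl_act (rG g) probe =
  lin (- shift g) - \sum_(j < n.+1 | j != xn) lin (col j (move g)) * 'X_ord0 ^+ (j.+1).*2.
Proof.
move=> gG; rewrite rmorphD rmorph_sum /= opprD addrACA; congr (_ + _).
  by rewrite linN -gl_act_last opprB.
rewrite -sumrB -sumrN; apply: eq_bigr => j _.
by rewrite rmorphM rmorphXn /= gl_act_first // -mulrBl -opprB gl_act_var mulNr.
Qed.

Lemma probe_diff_fixl g : g \in G -> fixl g ->
  probe - gl_act (rG g) probe = lin (- shift g).
Proof.
move=> gG fg; rewrite probe_diff // big1 ?subr0 // => j ne.
by rewrite fixl_col // linear0 mul0r.
Qed.

(* The forms [g x_j - x_j], [j < n], only involve variables below [r] and so survive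
   the substitution; the exponents in [probe] put them in distinct degrees. *)
Lemma shift_not_divides_probe g g' : g \in G -> g \notin N -> g' \in G -> ~~ fixl g' ->
  ~ divides (lin (- shift g)) (probe - gl_act (rG g') probe).
Proof.
move=> gG gN g'G nf; have vr : (- shift g) r 0 != 0 by rewrite mxE oppr_eq0 shift_r_eq0.
rewrite (dividesP _ vr) probe_diff // rmorphB /= gl_act_lin rmorph_sum /=.
set w := _ *m _; have [i ne] := not_fixl_col nf; move/cV0Pn => [l il].
have lb : (l < b)%N by rewrite ltnNge; apply: contraNN il => bl; rewrite mxE move_above.
(* From [l < b <= r]: the eliminated variable is not [x_1], so the weights survive the
   substitution. *)
have r0 : ord0 != r.
  by rewrite -val_eqE /= eq_sym -lt0n (leq_ltn_trans (leq0n _) (leq_trans lb br)).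
have killX j : j != xn ->
    gl_act (kill_mx (- shift g) r) (lin (col j (move g')) * 'X_ord0 ^+ (j.+1).*2)
      = lin (col j (move g')) * 'X_ord0 ^+ (j.+1).*2.
  move=> jn; rewrite rmorphM rmorphXn /= lin_delta !gl_act_lin !kill_mxE.
  rewrite [X in X / _]mxE (move_above g'G jn br) mul0r scale0r subr0.
  by rewrite [(delta_mx _ _ : 'cV[k]_n.+1) r 0]mxE eq_sym (negPf r0) mul0r scale0r subr0.
under eq_bigr => j jn do rewrite killX //.
have degX e : mdeg (U_(ord0 : 'I_n.+1) *+ e) = e by rewrite mdegMn mdeg1 mul1n.
have hom j : lin (col j (move g')) * 'X_ord0 ^+ (j.+1).*2 \is (1 + (j.+1).*2).-homog.
  by apply: dhomogM; [exact: lin_homog | rewrite mpolyXn dhomogX; apply/eqP/degX].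
(* The coefficient of this monomial isolates the nonzero entry [(l, i)] of [move g']: its degree
   excludes the linear term and every other summand. *)
pose m := (U_(ord0) *+ (i.+1).*2 + U_(l))%MM.
have dm : mdeg m = (1 + (i.+1).*2)%N by rewrite mdegD degX mdeg1 addnC.
have : (lin w)@_m = 0 by apply: (dhomog_nemf_coeff (lin_homog w)); rewrite /= dm add1n doubleS.
move: (lin w) => lw lw0 /(congr1 (mcoeff m)).
rewrite mcoeff0 mcoeffB lw0 sub0r raddf_sum /= (bigD1 i) //= big1 ?addr0.
  rewrite mpolyXn mcoeffMX mcoeff_lin.
  by move/eqP; rewrite oppr_eq0 (negPf il).
move=> j /andP[_ ji]; apply: (dhomog_nemf_coeff (hom j)); rewrite /= dm.
by apply: contra ji => /eqP/addnI/double_inj[] e; apply/eqP/val_inj.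
Qed.

Lemma fixl_inverse_exponent (m : nat) : (0 < m < p)%N ->
  exists m', (shift s r 0 *+ (m * m') = shift s r 0) /\
             (forall g, g \in G -> fixl g -> (g ^+ (m * m') = g)%g).
Proof.
move=> /andP[m0 mp].
have co : coprime m p by rewrite coprime_sym prime_coprime // gtnNdvd.
have [m' q e _] := egcdnP p m0; move: e; rewrite (eqP co) mulnC => e.
exists m'; rewrite e; split=> [|g gG fg].
  rewrite mulrnDr mulr1n mulnC mulrnA; have /eqP -> : shift s r 0 *+ p == 0.
    by rewrite natr_mul_eq0 dvdnn.
  by rewrite mul0rn add0r.
by rewrite expgD mulnC expgM fixl_expgp // expg1n mul1g.
Qed.

(** Raising to the power [m] maps [sH] bijectively onto the index set, with inverse the power [m'],
    and multiplies each [shift] by [m]; the scalar is a power of [- m]. *)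
Lemma prod_fixl_power (m : nat) : (0 < m < p)%N -> exists2 c : k, c != 0 &
  \prod_(g in G | fixl g && (shift g r 0 == shift s r 0 *+ m)) lin (- shift g) = c *: disc.
Proof.
move=> mp; have [m' [em' gm']] := fixl_inverse_exponent mp.
exists (\prod_(t in sH) - (m%:R : k)).
  apply/prodf_neq0 => t _; rewrite oppr_eq0 -(dvdn_pcharf hp).
  by case/andP: mp => m0 mp; rewrite gtnNdvd.
rewrite -scaler_prod (reindex_onto (fun t => t ^+ m)%g (fun g => g ^+ m')%g) /=; last first.
  by move=> g /and3P[gG fg _]; rewrite -expgM mulnC gm'.
apply: eq_big => [t|t /andP[/and3P[uG fu _] /eqP et]]; last first.
  have tG : t \in G by rewrite -et groupX.
  have [ft _] := fixlX m' uG fu; rewrite et in ft.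
  by have [_ ->] := fixlX m tG ft; rewrite -scaler_nat linN scaleNr linearZ.
apply/idP/idP => [/andP[/and3P[uG fu /eqP eu] /eqP et]|].
  rewrite -et inE groupX //; have [-> ->] := fixlX m' uG fu.
  by rewrite mulmxnE eu -mulrnA em' eqxx.
rewrite inE => /and3P[tG ft /eqP et]; have [-> ->] := fixlX m tG ft.
by rewrite groupX // mulmxnE et eqxx -expgM gm' // eqxx.
Qed.

Lemma shift_r_multiple g : g \in G -> exists m0 : 'I_p,
  (m0 != 0 :> nat) = (g \notin N) /\
  forall m : 'I_p, (shift g r 0 == shift s r 0 *+ m) = (m == m0).
Proof.
move=> gG; have [m0 gN] := cosetG gG; exists m0; split.
  rewrite -shift_r_eq0 // (shift_coset gG gN) natr_mul_eq0 (negPf s_r) orbF.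
  by have [->|m_gt0] := posnP m0; rewrite ?dvdn0 ?gtnNdvd.
move=> m; rewrite (shift_coset gG gN); apply/eqP/eqP => [e|-> //].
have lt_neq (m1 m2 : 'I_p) : (m1 < m2)%N -> shift s r 0 *+ m1 != shift s r 0 *+ m2.
  move=> lt; rewrite eq_sym -subr_eq0 -mulrnBr ?(ltnW lt) // natr_mul_eq0 (negPf s_r) orbF.
  by rewrite gtnNdvd ?subn_gt0 // (leq_ltn_trans (leq_subr _ _)).
apply: val_inj; case: (ltngtP m m0) => // lt.
  by have := lt_neq _ _ lt; rewrite e eqxx.
by have := lt_neq _ _ lt; rewrite e eqxx.
Qed.

(** The elements are sorted by the coset exponent [m]; each of the [p - 1] nonzero values
    contributes one factor [disc] up to a scalar. *)
Lemma prod_fixl : exists2 c : k, c != 0 &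
  \prod_(g in G :\: N | fixl g) lin (- shift g) = c *: discP.
Proof.
have /fin_all_exists[c hc] : forall m : 'I_p, exists c : k, m != 0 :> nat -> c != 0 /\
    \prod_(g in G | fixl g && (shift g r 0 == shift s r 0 *+ m)) lin (- shift g) = c *: disc.
  (* The value 0 at [m = 0] is a placeholder; the product of the scalars omits it. *)
  move=> m; have [->|m0] := posnP m; first by exists 0.
  have [|c c0 e] := @prod_fixl_power m; first by rewrite m0 ltn_ord.
  by exists c.
exists (\prod_(m < p | m != 0 :> nat) c m).
  by apply/prodf_neq0 => m /hc[].
have -> : discP = \prod_(m < p | m != 0 :> nat) disc.
  rewrite prodr_const; congr (_ ^+ _).
  have := cardC1 (Ordinal (prime_gt0 p_pr)); rewrite card_ord => <-.
  by apply: eq_card => m; rewrite !inE -val_eqE.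
rewrite -scaler_prod; under [RHS]eq_bigr => m m0 do rewrite -(proj2 (hc m m0)).
rewrite (exchange_big_dep (fun g => (g \in G :\: N) && fixl g)) /=; last first.
  move=> m g m0 /and3P[gG -> /eqP e]; rewrite !inE gG andbT /= andbT.
  by rewrite -shift_r_eq0 // e natr_mul_eq0 (negPf s_r) orbF gtnNdvd // lt0n.
apply: eq_bigr => g /andP[]; rewrite inE => /andP[gN gG] fg.
have [m0 [m0N em]] := shift_r_multiple gG.
rewrite (big_pred1 m0) // => m; rewrite gG fg em /=.
by apply: andb_idl => /eqP ->; rewrite m0N.
Qed.

(** Comparing [y L = z1] with [y c discP q = z2] gives [z1 c discP q = z2 L]. No linear factor of
    [L] divides [q], so [L] divides [z1 c discP], and [y c discP] is a polynomial. *)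
Lemma codifferent_disc y : codifferent A R y -> in_frac A (y * tofrac discP).
Proof.
move=> Cy; have Fy : F y by case: Cy.
have [z1 e1] := codifferent_mul_prod_act 'X_xn Cy.
have [z2 e2] := codifferent_mul_prod_act probe Cy.
have [c c0 ec] := prod_fixl.
pose q := \prod_(g in G :\: N | ~~ fixl g) (probe - gl_act (rG g) probe).
have {}e2 : y * tofrac (c *: discP * q) = tofrac z2.
  rewrite -e2 (bigID (fun g => fixl g)) /= -ec; congr (_ * tofrac (_ * _)).
  apply: eq_bigr => g /andP[]; rewrite inE => /andP[_ gG] fg.
  by rewrite probe_diff_fixl.
pose L := \prod_(g <- enum (G :\: N)) lin (- shift g).
have {}e1 : y * tofrac L = tofrac z1.
  rewrite -e1 /L big_enum /=; congr (_ * tofrac _); apply: eq_bigr => g _.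
  by rewrite linN -gl_act_last opprB.
have [w ew] : divides L (z1 * (c *: discP)).
  apply: (prod_lin_divides_cancel (g := q)) => [g|g|].
  - by rewrite mem_enum inE oppr_eq0 => /andP[gN gG]; apply: shift_neq0.
  - rewrite mem_enum inE => /andP[gN gG].
    have vr : (- shift g) r 0 != 0 by rewrite mxE oppr_eq0 shift_r_eq0.
    rewrite (dividesP _ vr) rmorph_prod; apply/eqP/prodf_neq0 => g' /andP[].
    rewrite inE => /andP[_ g'G] nf; apply/eqP; rewrite -(dividesP _ vr).
    exact: shift_not_divides_probe.
  exists z2; apply: tofrac_inj; rewrite -mulrA !tofracM -e1 -e2 !tofracM.
  by rewrite mulrAC !mulrA.
have L0 : L != 0.
  rewrite /L big_enum; apply/prodf_neq0 => g; rewrite inE => /andP[gN gG].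
  by rewrite lin_eq0 oppr_eq0 shift_neq0.
have ez : y * tofrac discP = tofrac (c^-1 *: w).
  have : y * tofrac (c *: discP) = tofrac w.
    apply: (mulfI (x := tofrac L)); first by rewrite tofrac_eq0.
    by rewrite mulrCA mulrA e1 -!tofracM ew mulrC.
  move=> ew'; rewrite -mul_mpolyC tofracM -ew' mulrCA -tofracM mul_mpolyC.
  by rewrite scalerA mulVf // scale1r.
exists (c^-1 *: w) => // h hN; apply: tofrac_inj; have hi := actG_inj (NG hN).
rewrite -[LHS](frac_map_tofrac hi) -ez (frac_mapM hi) (frac_fieldN_fix Fy hN).
by rewrite (frac_map_tofrac hi) /= discP_invariant ?NG.
Qed.

(** * The normalized linear forms of the outer transvections *)

Lemma beta_outer t : t \in G -> t \notin N -> beta (rG t) = r.+1.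
Proof.
move=> tG tN; apply: (@beta_eq _ _ _ xn).
  by have := shift_r_eq0 tG; rewrite mxE (negPf tN) => ->.
move=> j i rj; have [->|ne] := eqVneq i xn; first by have := shift_above tG rj; rewrite mxE.
exact: move_above tG ne (leq_trans br (ltnW rj)).
Qed.

Definition normal_form v : S := lin ((v r 0)^-1 *: v).

Let ideal_gen1 (l f : S) : ideal_gen (eq l) f <-> divides l f.
Proof.
split=> [[m [a [x [xl ->]]]]|[q ->]].
  by exists (\sum_(i < m) a i); rewrite mulr_suml; apply: eq_bigr => i _; rewrite -xl.
by exists 1%N, (fun=> q), (fun=> l); rewrite big_ord1.
Qed.

(** Only [x_n] is moved by [t], so the ideal of all differences is generated by [t x_n - x_n]; its
    leading variable is [x_r], where the coefficient is scaled to 1. *)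
Lemma normal_form_lform t : t \in G -> t \notin N -> fixl t ->
  is_lform (rG t) (normal_form (shift t)).
Proof.
move=> tG tN ft; have tr : shift t r 0 != 0 by rewrite shift_r_eq0.
have eX i : gl_act (rG t) 'X_i - 'X_i = if i == xn then lin (shift t) else 0.
  have [->|ne] := eqVneq i xn; first exact: gl_act_last.
  by rewrite gl_act_var fixl_col // linear0.
have enf : normal_form (shift t) = (shift t r 0)^-1 *: lin (shift t).
  by rewrite /normal_form linearZ.
split; first exact: lin_homog.
  move=> f; rewrite ideal_gen1; split.
    move=> [m [a [x [hx ->]]]]; elim/big_ind: _ => [|? ?|i _]; last 1 first.
    - have [h ->] := hx i; apply: dividesMl; apply: gl_act_divides => i'; rewrite eX.
      case: (i' == xn); last by exists 0; rewrite mul0r.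
      by exists (shift t r 0)%:MP; rewrite mul_mpolyC enf scalerA divff // scale1r.
    - by exists 0; rewrite mul0r.
    exact: dividesD.
  move=> [q ->]; exists 1%N, (fun=> (shift t r 0)^-1 *: q), (fun=> lin (shift t)).
  split; first by move=> _; exists 'X_xn; rewrite gl_act_last.
  by rewrite big_ord1 enf -scalerAl -scalerAr.
by exists r; rewrite ?beta_outer // mcoeff_lin mxE mulVf.
Qed.

(** Two generators divide each other, so they differ by a unit, which is a constant; the common
    normalized coefficient makes it 1. *)
Lemma is_lform_uniq (M : 'M[k]_n.+1) (l1 l2 : S) : is_lform M l1 -> is_lform M l2 -> l1 = l2.
Proof.
move=> [_ id1 [j1 ej1 c1]] [_ id2 [j2 ej2 c2]].
have ej : j1 = j2 by apply/val_inj/succn_inj; rewrite ej1 ej2.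
have div12 (f : S) : divides l1 f <-> divides l2 f by rewrite -!ideal_gen1 -id1 id2.
have [q1 e1] : divides l1 l2 by apply/div12; exists 1; rewrite mul1r.
have [q2 e2] : divides l2 l1 by apply/div12; exists 1; rewrite mul1r.
have l10 : l1 != 0 by apply: contra_eq_neq c1 => ->; rewrite mcoeff0 eq_sym oner_eq0.
have q21 : q2 * q1 = 1 by apply: (mulIf l10); rewrite mul1r -mulrA -e1.
have /andP[/eqP eq1 _] := mpoly_intro_unit q21.
move: c2; rewrite e1 eq1 mul_mpolyC mcoeffZ -ej c1 mulr1 => ->.
by rewrite scale1r.
Qed.

Lemma lformE t : t \in G -> t \notin N -> fixl t -> lform (rG t) = normal_form (shift t).
Proof.
move=> tG tN ft; have nf := normal_form_lform tG tN ft.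
apply: (is_lform_uniq _ nf); exact: epsilon_spec (ex_intro _ _ nf).
Qed.

(** A suitable power of an outer transvection lies in [sH] and has a proportional [shift], hence the
    same normalized form. Distinct elements of [sH] have distinct forms. *)
Lemma lform_set_perm :
  perm_eq (undup [seq lform (rG t) | t in transvections rG G :\: N])
          [seq normal_form (shift t) | t <- enum sH].
Proof.
have nfE t : t \in sH -> normal_form (shift t) = (shift s r 0)^-1 *: lin (shift t).
  by rewrite inE => /and3P[_ _ /eqP tr]; rewrite /normal_form linearZ tr.
apply: uniq_perm; first exact: undup_uniq.
  rewrite map_inj_in_uniq ?enum_uniq // => t t'; rewrite !mem_enum => tH t'H.
  rewrite !nfE // => /(scalerI (invr_neq0 s_r)) /lin_inj e.
  move: tH t'H; rewrite !inE => /and3P[tG ft _] /and3P[t'G ft' _].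
  exact: fixl_shift_inj.
move=> l; rewrite mem_undup outer_transvectionsE; apply/imageP/mapP => [[t]|[t]].
  rewrite !inE => /andP[/andP[tN tG] ft] ->.
  have [m0 [m0N em0]] := shift_r_multiple tG.
  have [|m' [em' gm']] := @fixl_inverse_exponent m0; first by rewrite lt0n m0N tN ltn_ord.
  have [ftm etm] := fixlX m' tG ft.
  have rtm : shift (t ^+ m')%g r 0 = shift s r 0.
    have /eqP tr : shift t r 0 == shift s r 0 *+ m0 by rewrite em0.
    by rewrite etm mulmxnE tr -mulrnA em'.
  exists (t ^+ m')%g; first by rewrite mem_enum inE groupX // ftm rtm eqxx.
  rewrite lformE // /normal_form etm -scaler_nat; congr lin.
  rewrite [X in _ = X^-1 *: _]mxE scalerA invfM mulrAC mulVf ?mul1r //.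
  apply: contraNneq s_r => m'0.
  by rewrite -rtm etm -scaler_nat m'0 scale0r mxE.
rewrite mem_enum => tH ->; exists t; last first.
  rewrite lformE // ?sH_notin //; by move: tH; rewrite inE => /and3P[].
by rewrite !inE sH_notin //; move: tH; rewrite inE => /and3P[-> -> _].
Qed.

Lemma prod_lform : exists2 c : k, c != 0 &
  \prod_(l <- undup [seq lform (rG t) | t in transvections rG G :\: N]) l ^+ p.-1 = c *: discP.
Proof.
exists (((shift s r 0)^-1 ^+ #|sH|) ^+ p.-1); first by rewrite !expf_neq0 ?invr_neq0.
rewrite (perm_big _ lform_set_perm) big_map prodrXl -exprZn; congr (_ ^+ _).
rewrite big_enum /= -prodr_const -scaler_prod; apply: eq_bigr => t.
by rewrite inE => /and3P[_ _ /eqP tr]; rewrite /normal_form linearZ tr.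
Qed.

(** * The orbit product and the generator of the different *)

Lemma orbit_prod_diff :
  gl_act (rG s) (orbit_prod rG (Hgrp rG N) 'X_xn) - orbit_prod rG (Hgrp rG N) 'X_xn = disc.
Proof.
pose H := [set g in N | fixl g]; pose V := [seq lin (shift h) | h <- enum H].
have HG h : h \in H -> h \in G by rewrite inE => /andP[/NG].
have Hf h : h \in H -> fixl h by rewrite inE => /andP[].
have HM g h : g \in H -> h \in H -> (g * h)%g \in H /\ shift (g * h)%g = shift g + shift h.
  move=> gH hH; have [fgh ->] := fixlM (HG _ gH) (HG _ hH) (Hf _ gH) (Hf _ hH).
  by move: gH hH; rewrite !inE => /andP[gN _] /andP[hN _]; rewrite groupM.
have uV : uniq V.
  rewrite map_inj_in_uniq ?enum_uniq // => g h; rewrite !mem_enum => gH hH /lin_inj.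
  by apply: fixl_shift_inj; rewrite ?HG ?Hf.
have V0 : 0 \in V.
  have [f1 e1] := fixl1; have -> : 0 = lin (shift 1%g) by rewrite e1 linear0.
  apply: map_f; by rewrite mem_enum inE group1.
have VD : {in V &, forall a c, a + c \in V}.
  move=> _ _ /mapP[g gH ->] /mapP[h hH ->]; move: gH hH; rewrite !mem_enum => gH hH.
  by have [ghH e] := HM _ _ gH hH; rewrite -linearD -e; apply: map_f; rewrite mem_enum.
have eX h : gl_act (rG h) 'X_xn = 'X_xn + lin (shift h).
  by rewrite -gl_act_last addrC subrK.
have -> : orbit_prod rG (Hgrp rG N) 'X_xn = \prod_(w <- V) ('X_xn + w).
  rewrite /orbit_prod Hgrp_fixl -/H -(big_map (fun w => 'X_xn + w) predT id).
  apply: perm_big; apply: uniq_perm; rewrite ?undup_uniq ?(map_inj_uniq (@addrI _ _)) //.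
  move=> f; rewrite mem_undup; apply/imageP/mapP => [[h hH ->]|[w /mapP[h hH ->] ->]].
    by exists (lin (shift h)); [apply: map_f; rewrite mem_enum | rewrite eX].
  by exists h; rewrite ?eX // -mem_enum.
rewrite rmorph_prod.
(* [s] fixes each [w], which does not involve [x_n], so it only translates [x_n] by [lin (shift s)];
   [additive_product] then applies. *)
have -> : \prod_(w <- V) gl_act (rG s) ('X_xn + w) = \prod_(w <- V) ('X_xn + lin (shift s) + w).
  rewrite big_seq [RHS]big_seq; apply: eq_bigr => w /mapP[h]; rewrite mem_enum => hH ->.
  rewrite rmorphD /= eX gl_act_lin; congr (_ + lin _).
  have -> : rG s *m shift h = move s *m shift h + shift h by rewrite mulmxBl mul1mx subrK.
  by rewrite move_shift_fix ?add0r ?fixl_s ?HG.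
rewrite (additive_product _ _ uV V0 VD) addrAC subrr add0r discE big_map big_enum /=.
by apply: eq_bigr => h _; rewrite linearD.
Qed.

(** [discP] lies in the different, so [discP = a Delta]. Its inverse lies in the codifferent, so
    [Delta = c discP]. Then [a c = 1], and units of the polynomial ring are nonzero constants. *)
Lemma different_generator Delta :
  homog_generator A (dedekind_different A R) Delta -> eq_upto_scalar Delta discP.
Proof.
move=> [_ _ hD]; have d0 : discP != 0 by rewrite expf_neq0 ?disc_neq0.
have [|a _ ea] := proj1 (hD (tofrac discP)).
  split; last by move=> y Cy; rewrite mulrC; apply: codifferent_disc.
  exists discP, 1; split; rewrite ?oner_eq0 ?tofrac1 ?divr1 //.
    by move=> g gN; apply/discP_invariant/NG.
  by move=> g _; apply: rmorph1.
have [|_ /(_ _ inv_disc_codifferent)[c _ ec]] := proj2 (hD (tofrac Delta)).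
  by exists 1; rewrite ?mul1r // => g _; apply: rmorph1.
have eD : Delta = c * discP.
  by apply: tofrac_inj; rewrite tofracM -ec divfK ?tofrac_eq0.
have ac : a * c = 1.
  by apply: (mulIf d0); rewrite mul1r -mulrA -eD -(tofrac_inj ea).
have /andP[/eqP ecc] := mpoly_intro_unit ac; rewrite unitfE => c0.
by exists c@_0%MM; rewrite // eD {1}ecc mul_mpolyC.
Qed.

End LeadingIndex.
End LastTransvection.

Theorem proposition4p6 (p : nat) (k : fieldType) (hp : p \in [pchar k]) (n : nat)
    (gT : finGroupType) (G : {group gT}) (rG : mx_representation k G n.+1)
    (hfaithful : mx_faithful rG) (hpG : (p.-group G)%g)
    (hgen : <<transvections rG G>>%g = G)
    (htri : unitriangular rG)
    (G' : {group gT})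
    (hG' : penultimate_term p rG G')
    (hbeta : forall t, t \in transvections rG G -> t \notin G' ->
       (beta_grp rG G' <= beta (rG t))%N)
    (sigma : gT) (hsigma : sigma \in transvections rG G)
    (hsigmaG' : sigma \notin G')
    (hquo : (G / G')%g = <[coset G' sigma]>%g)
    (hbeta_sigma : (beta_grp rG G' < beta (rG sigma))%N)
    (hsigma_fix : forall i : 'I_n.+1, i != ord_max -> gl_act (rG sigma) 'X_i = 'X_i)
    (Delta : {mpoly k[n.+1]})
    (hDelta : homog_generator (is_invariant rG G')
       (dedekind_different (is_invariant rG G') (is_invariant rG G)) Delta) :
  let PiH := orbit_prod rG (Hgrp rG G') 'X_ord_max in
  let prod_l :=
    \prod_(l <- undup [seq lform (rG t) | t in transvections rG G :\: G'])
      l ^+ p.-1 in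
  eq_upto_scalar Delta prod_l /\
  eq_upto_scalar prod_l ((gl_act (rG sigma) PiH - PiH) ^+ p.-1).
Proof.
have [nG'G genG'] : (G' <| G)%g /\ <<transvections rG G'>>%g = G'.
  have [m [Gs [[Gs0 GsG Gs_step] <-]]] := hG'.
  have [[_ nG] _ _ _ _] := Gs_step m (ltnSn m).
  split; first by rewrite -GsG.
  (* Generation of [G'] by transvections comes from the preceding step of the series; at index 0
     there is none, but then the group is trivial. *)
  case: m Gs_step {GsG nG} => [|m] Gs_step; last by have [] := Gs_step m (ltnW (ltnSn m.+1)).
  rewrite Gs0; apply/eqP; rewrite eqEsubset sub1G andbT gen_subG.
  by apply/subsetP => g; rewrite inE => /andP[].
have [r [sr br sr0]] := leading_index hbeta_sigma hsigma_fix.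
have [c c0 eDelta] := different_generator hp hfaithful htri nG'G genG' hsigma hsigmaG' hquo
  hsigma_fix sr br hDelta.
have [d d0 ed] := prod_lform hp hfaithful htri nG'G genG' hsigma hquo hsigma_fix sr br sr0.
have ePi := orbit_prod_diff hp hfaithful htri nG'G genG' hsigma hquo hsigma_fix sr br.
move=> PiH prod_l; rewrite /prod_l ed /PiH ePi; split; last by exists d.
by exists (c / d); [rewrite mulf_neq0 ?invr_eq0 | rewrite scalerA divfK].
Qed.
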